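(* For every $\lambda>0$ and all metric measure spaces $\mathcal{X}_1,\mathcal{X}_2$, $$ \min\{2,\tfrac1\lambda\}\cdot d_{\mathrm{GP}}(\mathcal{X}_1,\mathcal{X}_2)\ \le\ \underline{\Box}_\lambda(\mathcal{X}_1,\mathcal{X}_2)\ \le\ \max\{2,\tfrac1\lambda\}\cdot d_{\mathrm{GP}}(\mathcal{X}_1,\mathcal{X}_2). $$ In particular, $\underline{\Box}_1$ induces the Gromov-weak topology on the space $\mathbb{M}$ of isomorphism classes of metric measure spaces.
   Context: A metric measure space (mm-space) is a triple $\mathcal{X}=(X,d,\mu)$ where $(X,d)$ is a complete separable metric space and $\mu$ is a probability measure on the Borel $\sigma$-algebra of $X$. Two mm-spaces $(X,d,\mu)$ and $(X',d',\mu')$ are isomorphic (and are not distinguished) if there is a measure preserving map $f\colon X\to X'$ (i.e. $\mu'=\mu\circ f^{-1}$) with $d(x,y)=d'(f(x),f(y))$ for all $x,y\in\mathrm{supp}(\mu)$. $\mathbb{M}$ denotes the space of isomorphism classes of mm-spaces. Prohorov distance: for probability measures $\mu,\nu$ on a metric space $(X,d)$, $d_{\mathrm{Pr}}(\mu,\nu)=\inf\{\varepsilon>0 : \mu(A)\le \nu(A^\varepsilon)+\varepsilon \text{ for all Borel } A\subseteq X\}$, where $A^\varepsilon=\{x\in X: d(A,x)<\varepsilon\}$. Gromov-Prohorov metric: for mm-spaces $\mathcal{X}_i=(X_i,d_i,\mu_i)$, $i=1,2$, $d_{\mathrm{GP}}(\mathcal{X}_1,\mathcal{X}_2)=\inf_{f,g}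 d_{\mathrm{Pr}}(\mu_1\circ f^{-1},\mu_2\circ g^{-1})$, where the infimum is over all isometries (isometric embeddings) $f\colon X_1\to X$, $g\colon X_2\to X$ into a common separable metric space $(X,d)$. Metric $\Box_\lambda$ ($\lambda>0$): for a probability space $(X,\mathfrak{B},\mu)$ and functions $r,s\colon X\times X\to\mathbb{R}$, $\Box_\lambda(r,s)=\inf\{\varepsilon>0 : \exists X_\varepsilon\in\mathfrak{B} \text{ with } \sup_{x,y\in X_\varepsilon}|r(x,y)-s(x,y)|\le\varepsilon \text{ and } \mu(X\setminus X_\varepsilon)\le\lambda\varepsilon\}$. Gromov's metric $\underline{\Box}_\lambda$: let $I=[0,1]$ with Lebesgue measure. For an mm-space $\mathcal{X}=(X,d,\mu)$ let $\mathcal{F}(\mathcal{X})$ be the (non-empty) set of measure preserving maps $\varphi\colon I\to X$ (parametrisations), and $d_\varphi(s,t)=d(\varphi(s),\varphi(t))$ for $s,t\in I$. Then $\underline{\Box}_\lambda(\mathcal{X},\mathcal{X}')=\inf_{\varphi\in\mathcal{F}(\mathcal{X}),\,\varphi'\in\mathcal{F}(\mathcal{X}')}\Box_\lambda(d_\varphi,d'_{\varphi'})$, where $\Box_\lambda$ is taken on $I$ with Lebesgue measure. Gromov-weak topology: a polynomial on $\mathbb{M}$ is a function $\Phi\colon\mathbb{M}\to\mathbb{R}$ of the form $\Phi(\mathcal{X})=\int_{X^n}\phi\big((d(x_i,x_j))_{i,j\le n}\big)\,\mu^{\otimes n}(dx)$ for $\mathcal{X}=(X,d,\mu)$, where $n\in\mathbb{N}$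 and $\phi\colon\mathbb{R}^{n\times n}\to\mathbb{R}$ is bounded and continuous. The Gromov-weak topology is the topology on $\mathbb{M}$ induced by the set of all polynomials (the coarsest topology making all of them continuous). It is a known result of Greven, Pfaffelhuber and Winter that $d_{\mathrm{GP}}$ is a metric on $\mathbb{M}$ inducing the Gromov-weak topology. *)

(* Defs.v *)
From HB Require Import structures.
From mathcomp Require Import all_boot all_order all_algebra.
From mathcomp Require Import all_classical all_reals all_analysis.

Set Implicit Arguments.
Unset Strict Implicit.
Unset Printing Implicit Defensive.

Import Order.TTheory GRing.Theory Num.Theory.
Import numFieldNormedType.Exports.

Local Open Scope classical_set_scope.
Local Open Scope ring_scope.

(* Pointedness is only there because the measurable types of the library are
   pointed; a space carrying a probability measure is nonempty anyway. *)
#[short(type="pmetricType")]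
HB.structure Definition PointedMetric (R : numDomainType) :=
  {T of Metric R T & isPointed T}.

#[short(type="completeMetricType")]
HB.structure Definition CompleteMetric (R : numDomainType) :=
  {T of Complete T & PointedMetric R T}.

Definition borel (T : ptopologicalType) := g_sigma_algebraType (@open T).

Definition separable (T : topologicalType) :=
  exists2 S : set T, countable S & dense S.

Definition isometric (R : realType) (X Y : metricType R) (f : X -> Y) :=
  forall x y, mdist (f x) (f y) = mdist x y.

(* nu is the image under f of the restriction of mu to D. *)
Definition measure_preserving (R : realType) d d' (T : measurableType d)
    (T' : measurableType d') (D : set T) (mu : set T -> \bar R)
    (nu : set T' -> \bar R) (f : T -> T') :=
  measurable_fun D f /\
  forall A, measurable A -> nu A = mu (D `&` f @^-1` A).

Definition supp (R : realType) (T : ptopologicalType)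
    (mu : set (borel T) -> \bar R) : set T :=
  [set x | forall U : set T, open U -> U x -> (0 < mu U)%E].

Section product_power.
Context d (T : measurableType d) (R : realType).

Definition tcons n (xs : T * n.-tuple T) : n.+1.-tuple T :=
  [tuple of xs.1 :: xs.2].

Lemma measurable_tcons n : measurable_fun [set: T * n.-tuple T] (@tcons n).
Proof. exact: measurable_cons. Qed.

HB.instance Definition _ n :=
  isMeasurableFun.Build _ _ _ _ (@tcons n) (@measurable_tcons n).

Fixpoint product_measure_power (mu : probability T R) n : probability (n.-tuple T) R :=
  match n with
  | 0 => \d_([tuple])
  | n'.+1 => distribution (mu \x product_measure_power mu n')%E (@tcons n')
  end.

End product_power.

(* For probability measures and 0 < lambda, the sets of reals whose infimum is
   taken below are nonempty and bounded below by 0, so that inf does not take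
   its default value. *)

Section distances.
Context (R : realType).

Definition eneighbourhood (X : metricType R) (A : set X) (e : R) : set X :=
  [set x | (ereal_inf [set (mdist a x)%:E | a in A] < e%:E)%E].

Definition prohorov (X : pmetricType R) (mu nu : set (borel X) -> \bar R) : R :=
  inf [set e | 0 < e /\ forall A : set (borel X), measurable A ->
                 (mu A <= nu (eneighbourhood A e) + e%:E)%E].

(* The space underlying the probability space is the measurable subset D of T,
   with the trace sigma-algebra. *)
Definition box d (T : measurableType d) (D : set T) (mu : set T -> \bar R)
    (lambda : R) (r s : T -> T -> R) : R :=
  inf [set e | 0 < e /\ exists A : set T,
        [/\ measurable A, A `<=` D,
            forall x y, A x -> A y -> `|r x y - s x y| <= e &
            (mu (D `\` A) <= (lambda * e)%:E)%E]].

End distances.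

Record mmspace (R : realType) := MMSpace {
  mm_carrier :> completeMetricType R ;
  mm_separable : separable mm_carrier ;
  mm_measure : probability (borel mm_carrier) R
}.

Section mmspaces.
Context (R : realType).
Implicit Types X Y : mmspace R.

Definition mm_iso X Y := exists f : X -> Y,
  measure_preserving (T := borel X) (T' := borel Y) setT
    (mm_measure X) (mm_measure Y) f /\
  forall x y, supp (mm_measure X) x -> supp (mm_measure X) y ->
    mdist x y = mdist (f x) (f y).

(* The maps f and g are continuous, hence Borel. *)
Definition gromov_prohorov X Y : R :=
  inf [set r | exists (Z : pmetricType R) (f : X -> Z) (g : Y -> Z),
        [/\ separable Z, isometric f, isometric g &
            r = prohorov (X := Z)
                  (pushforward (T1 := borel X) (T2 := borel Z) (mm_measure X) f)
                  (pushforward (T1 := borel Y) (T2 := borel Z) (mm_measure Y) g)]].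

Definition unit_interval : set (measurableTypeR R) := `[0, 1]%classic.

(* Parametrisations of X are functions on R of which only the restriction to
   [0, 1] (with its Borel sigma-algebra) matters. *)
Definition parametrisation X (phi : measurableTypeR R -> X) :=
  measure_preserving (T' := borel X) unit_interval (@lebesgue_measure R)
    (mm_measure X) phi.

Definition gromov_box (lambda : R) X Y : R :=
  inf [set r | exists (phi : measurableTypeR R -> X)
                      (psi : measurableTypeR R -> Y),
        [/\ parametrisation phi, parametrisation psi &
            r = box unit_interval (@lebesgue_measure R) lambda
                  (fun s t => mdist (phi s) (phi t))
                  (fun s t => mdist (psi s) (psi t))]].

Definition mmclass : Type :=
  {C : set (mmspace R) | exists X, C = [set Y | mm_iso X Y]}.

HB.instance Definition _ := gen_eqMixin mmclass.
HB.instance Definition _ := gen_choiceMixin mmclass.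

Definition mm_class X : mmclass :=
  exist _ [set Y | mm_iso X Y] (ex_intro _ X erefl).

Definition mm_polynomial (Phi : mmclass -> R) :=
  exists (n : nat) (phi : 'M[R]_n -> R),
    [/\ continuous phi, exists M : R, forall D, `|phi D| <= M &
        forall X, Phi (mm_class X) =
          \int[product_measure_power (mm_measure X) n]_x
            phi (\matrix_(i, j) mdist (tnth x i : X) (tnth x j : X))].

Definition gromov_weak :=
  sup_topology (fun Phi : {Phi | mm_polynomial Phi} =>
    Topological.class (initial_topology (sval Phi))).

HB.instance Definition _ := Topological.on gromov_weak.

End mmspaces.

Definition induces_topology (R : realType) (T : topologicalType)
    (delta : T -> T -> R) :=
  forall U : set T, open U <->
    forall x, U x -> exists2 e, 0 < e & [set y | delta x y < e] `<=` U.

(* Main.v *)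
Require Import Defs.
From HB Require Import structures.
From mathcomp Require Import all_boot all_order all_algebra.
From mathcomp Require Import all_classical all_reals all_analysis.
From mathcomp Require Import measurable_realfun lra.
Set Implicit Arguments.
Unset Strict Implicit.
Unset Printing Implicit Defensive.
Import Order.TTheory GRing.Theory Num.Theory.
Import numFieldNormedType.Exports.
Local Open Scope classical_set_scope.
Local Open Scope ring_scope.

(** Both metrics compare X and Y through a coupling.  Let phi and psi be
    parametrisations whose distances agree up to e on a set A of parameters
    whose complement has measure at most lambda e.  Declare phi s and psi s to
    correspond for s in A, and glue X and Y so that corresponding points lie at
    distance e / 2.  In the glued space the two measures have Prohorov distance
    at most max (e / 2) (lambda e); this is the lower bound
    [gromov_box_lower_bound].

    Conversely, if the images of the measures in a common space have Prohorov
    distance less than e, then Strassen's theorem provides a coupling of X and Y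
    under which, up to mass e, the two points are within e of each other, so
    that distances of pairs of points differ by at most 2 e.  A finite version
    up to arbitrarily small errors is enough: cut X and Y into finitely many
    small cells, observe that the Prohorov inequality becomes Hall's condition
    for the masses of the cells ([hall_coupling]), and spread the resulting
    transport plan over products of cells ([finite_coupling]).  A coupling is a
    measure on a Polish space, hence an image of Lebesgue measure on [0, 1]
    ([coded_parametrisation]), and its components are parametrisations.  This is
    [gromov_box_cells], which yields [gromov_box_upper_bound].

    For the topology, isomorphic spaces have distance 0, so Gromov's metric for
    lambda = 1 is defined on classes.  Polynomials are continuous for it
    ([polynomial_value_continuous]): for independent uniform parameters the
    distance matrices of X and Y are close with high probability.  It remains to
    find, for given X and e, a polynomial that is large at X and at no Y at
    distance e or more ([separating_polynomial]).  Choose points x i of the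
    support of X whose eta-balls cover X up to mass eta.  By the cell argument,
    Y is close to X as soon as it contains points y i with nearly the same
    mutual distances, such that balls around the y i with index in S have nearly
    as much mass as the balls around the corresponding x i, for every S
    ([gromov_box_le_matching]).  With masses replaced by integrals of continuous
    cutoffs, the failure of this is measured by a deviation V (y) that is a sum
    of truncated differences of distances and of squares of integrals.  The
    integral of (1 - V (y) / W) ^ m over y is the value of a polynomial, because
    a square of an integral is a double integral, and for large m it tells
    whether V is somewhere small: at X it decreases more slowly than
    (1 - kappa / W) ^ m, a bound for it at every Y on which V is at least
    kappa. *)

(** * Borel structure of a separable metric space *)

Section metric_borel.
Context (R : realType).

Lemma exists_invS_lt (r : R) : 0 < r -> exists k, k.+1%:R^-1 < r.
Proof.
move=> r0; exists (Num.truncn r^-1).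
by rewrite -[ltRHS]invrK ltf_pV2 ?posrE ?invr_gt0// truncnS_gt.
Qed.

Lemma measurable_ltr d (T : measurableType d) (D : set T) (f : T -> R) :
  (forall r, measurable (D `&` [set t | f t < r])) -> measurable_fun D f.
Proof.
move=> mf; apply: (measurability _ (RGenInftyO.measurableE R)).
move=> _ [_ [r ->] <-].
have <- : [set t | f t < r] = f @^-1` `]-oo, r[ by [].
exact: mf.
Qed.

Lemma open_mdist (X : metricType R) (x : X) (r : R) :
  open [set y | mdist x y < r].
Proof.
rewrite openE => y /= xyr; apply/metricType_numDomainType.nbhs_mdistP.
exists (r - mdist x y); first by rewrite /= subr_gt0.
by move=> z /= yz; rewrite (le_lt_trans (metric_triangle _ y _))// -ltrBrDl.
Qed.

Lemma metric_openP (X : metricType R) (U : set X) :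
  open U <-> forall x, U x -> exists2 r, 0 < r & [set y | mdist x y < r] `<=` U.
Proof.
rewrite openE; split => h x /h; last first.
  by move=> [r r0 rU]; apply/metricType_numDomainType.nbhs_mdistP; exists r.
by move=> /metricType_numDomainType.nbhs_mdistP[r r0 rU]; exists r.
Qed.

Lemma borel_open (X : ptopologicalType) (A : set X) :
  open A -> measurable (A : set (borel X)).
Proof. by move=> oA; apply: sub_sigma_algebra. Qed.

Lemma borel_ball (X : pmetricType R) (x : X) (r : R) :
  measurable ([set y | mdist x y < r] : set (borel X)).
Proof. by apply: borel_open; exact: open_mdist. Qed.

Lemma measurable_mdist (X : pmetricType R) (x : X) :
  measurable_fun [set: borel X] (fun y : borel X => mdist x (y : X)).
Proof.
by apply: measurable_ltr => r; apply: measurableI => //; exact: borel_ball.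
Qed.

Lemma isometric_measurable (X Z : pmetricType R) (f : X -> Z) : isometric f ->
  measurable_fun [set: borel X] (f : borel X -> borel Z).
Proof.
move=> isof; apply: (@measurability _ _ (borel X) (borel Z) _ _ (@open Z)) => //.
move=> _ [U oU <-]; rewrite setTI; apply: borel_open.
apply/metric_openP => x /= Ux; have /metric_openP/(_ _ Ux)[r r0 rU] := oU.
by exists r => // y /=; rewrite -isof => /rU.
Qed.

Lemma dense_seq (X : pmetricType R) : separable X ->
  exists z : nat -> X, forall x e, 0 < e -> exists n, mdist (z n) x < e.
Proof.
move=> [S cS dS].
have dS' x e : 0 < e -> exists2 s, S s & mdist s x < e.
  move=> e0.
  have [|s /= [xs Ss]] := dS [set y | mdist x y < e] _ (open_mdist _ _).
    by exists x; rewrite /= mdistxx.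
  by exists s => //; rewrite metric_sym.
have [s0 Ss0 _] := dS' point 1 ltr01.
have /pfcard_geP [S0|[z]] := cS; first by move: Ss0; rewrite S0.
exists z => x e e0; have [s Ss sx] := dS' x e e0.
by have [n _ zn] := @surj _ _ _ _ z s Ss; exists n; rewrite zn.
Qed.

Context (X : pmetricType R) (z : nat -> X).
Hypothesis dz : forall x e, 0 < e -> exists n, mdist (z n) x < e.

(** Every open set is a union of balls around points of the dense sequence with
    radii of the form 1/k, and there are countably many such balls. *)
Lemma measurable_fun_into d (T : measurableType d) (D : set T)
    (f : T -> borel X) :
  (forall n, measurable_fun D (fun t => mdist (z n) (f t : X))) ->
  measurable_fun D f.
Proof.
move=> mf mD; apply: (@measurability _ _ T (borel X) _ _ (@open X)) => // _ [U oU <-].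
pose inU n k := `[< [set y | mdist (z n) y < k.+1%:R^-1] `<=` U >].
rewrite [X in measurable X](_ : _ = \bigcup_n \bigcup_(k in [set k | inU n k])
  (D `&` [set t | mdist (z n) (f t : X) < k.+1%:R^-1])).
  apply: bigcupT_measurable => n; apply: bigcup_measurable => k _.
  rewrite (_ : [set t | _] = (fun t => mdist (z n) (f t : X)) @^-1`
    `]-oo, k.+1%:R^-1[); first exact: mf.
  by apply/seteqP; split => t /=; rewrite in_itv.
apply/seteqP; split => [t [Dt /= Uft]|t [n _ [k /= /asboolP kU [Dt /kU]]]//].
have /metric_openP/(_ _ Uft)[r r0 rU] := oU.
have [k kr] : exists k, k.+1%:R^-1 < r / 2.
  by apply: exists_invS_lt; rewrite divr_gt0.
have k0 : 0 < k.+1%:R^-1 :> R by rewrite invr_gt0.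
have [n nk] := dz (f t : X) k0.
exists n => //; exists k => //=; apply/asboolP => y /= ny; apply: rU => /=.
rewrite (le_lt_trans (metric_triangle _ (z n) _))// metric_sym [r]splitr.
by rewrite ltrD// (lt_trans _ kr).
Qed.

(** The distance of two points is below r iff for some n the sum of their
    distances to z n is. *)
Lemma measurable_mdist2 d (T : measurableType d) (D : set T)
    (f g : T -> borel X) : measurable_fun D f -> measurable_fun D g ->
  measurable_fun D (fun t => mdist (f t : X) (g t : X)).
Proof.
move=> mf mg mD; apply: measurable_ltr => // r.
pose h n t := mdist (z n) (f t : X) + mdist (z n) (g t : X).
have mh n : measurable_fun D (h n).
  by apply: measurable_funD; apply: (measurableT_comp (measurable_mdist (z n))).
rewrite [X in measurable X](_ : _ = \bigcup_n (D `&` [set t | h n t < r])).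
  apply: bigcup_measurable => n _.
  rewrite (_ : [set t | _] = (h n) @^-1` `]-oo, r[); first exact: mh.
  by apply/seteqP; split => t /=; rewrite in_itv.
apply/seteqP; split => [t [Dt /= fg]|t [n _ [Dt hr]]].
  have r0 : 0 < (r - mdist (f t : X) (g t : X)) / 2.
    by rewrite divr_gt0// subr_gt0.
  have [n nft] := dz (f t : X) r0.
  exists n => //; split => //; rewrite /h/=.
  have := metric_triangle (z n) (f t : X) (g t : X); lra.
split => //=; rewrite (le_lt_trans _ hr)// /h [X in _ <= X + _]metric_sym.
exact: metric_triangle.
Qed.

End metric_borel.

(** * Parametrisations by the unit interval *)

Definition mfun_of d d' (T : measurableType d) (T' : measurableType d')
    (f : T -> T') (mf : measurable_fun setT f) : {mfun T >-> T'} :=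
  HB.pack f (isMeasurableFun.Build _ _ _ _ f mf).

Section unit_interval_probability.
Context (R : realType).

Lemma measurable_unit_interval : measurable (@unit_interval R).
Proof. exact: measurable_itv. Qed.

Definition unif : set (measurableTypeR R) -> \bar R :=
  mrestr (@lebesgue_measure R) measurable_unit_interval.

HB.instance Definition _ := Measure.on unif.

Lemma lebesgue_unit_interval : lebesgue_measure (@unit_interval R) = 1%E.
Proof.
by have := @lebesgue_measure_itv R `[0, 1]; rewrite /= lte_fin ltr01 oppr0 adde0.
Qed.

Let unif_setT : unif setT = 1%E.
Proof. by rewrite /unif /mrestr setTI lebesgue_unit_interval. Qed.

HB.instance Definition _ := Measure_isProbability.Build _ _ _ unif unif_setT.

End unit_interval_probability.
Arguments unif R : clear implicits.

Section ternary_coding.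
Context (R : realType).
Implicit Types (a : nat -> bool) (r : R).

(** With digits 0 and 2 only, comparison with 1/2 reveals the first digit. *)
Definition ternary_sum a n : R := \sum_(k < n) 2 * (a k)%:R / 3 ^+ k.+1.

Lemma ternary_sumS a n :
  ternary_sum a n.+1 = 2 * (a 0)%:R / 3 + ternary_sum (fun k => a k.+1) n / 3.
Proof.
rewrite /ternary_sum big_ord_recl expr1 mulr_suml; congr (_ + _).
by apply: eq_bigr => i _; rewrite lift0 [in LHS]exprSr invfM mulrA.
Qed.

Lemma ternary_sum_le1 a n : 0 <= ternary_sum a n <= 1.
Proof.
elim: n a => [|n ih] a; first by rewrite /ternary_sum big_ord0 lexx ler01.
rewrite ternary_sumS; have := ih (fun k => a k.+1).
by case: (a 0); rewrite /= ?mulr1 ?mulr0; lra.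
Qed.

Lemma ternary_sum_nd a : nondecreasing_seq (ternary_sum a).
Proof.
apply/nondecreasing_seqP => n; rewrite /ternary_sum big_ord_recr/= lerDl.
by rewrite divr_ge0// ?mulr_ge0// exprn_ge0.
Qed.

Definition ternary a : R := limn (ternary_sum a).

Lemma cvg_ternary a : ternary_sum a @ \oo --> ternary a.
Proof.
apply: nondecreasing_is_cvgn; first exact: ternary_sum_nd.
by exists 1 => _ [n _ <-]; case/andP: (ternary_sum_le1 a n).
Qed.

Lemma ternary_le1 a : 0 <= ternary a <= 1.
Proof.
apply/andP; split.
  apply: limr_ge; first exact: cvg_ternary.
  by near=> n; case/andP: (ternary_sum_le1 a n).
apply: limr_le; first exact: cvg_ternary.
by near=> n; case/andP: (ternary_sum_le1 a n).
Unshelve. all: by end_near. Qed.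

Lemma ternaryS a : ternary a = 2 * (a 0)%:R / 3 + ternary (fun k => a k.+1) / 3.
Proof.
apply/cvg_lim => //; rewrite -cvg_shiftS.
rewrite (_ : [sequence _]_n = fun n =>
  2 * (a 0)%:R / 3 + ternary_sum (fun k => a k.+1) n / 3).
  by apply: cvgD; [exact: cvg_cst|apply: cvgMl; exact: cvg_ternary].
by apply/funext => n; rewrite /= ternary_sumS.
Qed.

(** Multiplication by 3 moves the first digit in front of the point, where it
    is removed. *)
Definition ternary_shift r := 3 * r - 2 * ((1 / 2 <= r)%R : nat)%:R.

Definition ternary_digit r k := 1 / 2 <= iter k ternary_shift r.

Lemma ternary_shiftE a : ternary_shift (ternary a) = ternary (fun k => a k.+1).
Proof.
rewrite /ternary_shift ternaryS; have := ternary_le1 (fun k => a k.+1).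
case: (a 0) => /= ?; rewrite ?mulr1 ?mulr0.
  by rewrite (_ : _ <= _ = true) /=; [lra|apply/idP; lra].
by rewrite (_ : _ <= _ = false) /=; [lra|apply/negP; lra].
Qed.

Lemma ternary_digitK a k : ternary_digit (ternary a) k = a k.
Proof.
rewrite /ternary_digit; elim: k a => [|k ih] a.
  rewrite /= ternaryS; have := ternary_le1 (fun k => a k.+1).
  by case: (a 0) => /= ?; rewrite ?mulr1 ?mulr0; [apply/idP|apply/negP]; lra.
by rewrite iterSr ternary_shiftE ih.
Qed.

Lemma measurable_ternary_digit k :
  measurable [set r : measurableTypeR R | ternary_digit r k].
Proof.
have mshift : measurable_fun setT (ternary_shift : measurableTypeR R -> R).
  apply: measurable_funB; first exact: measurable_funM.
  apply: measurable_funM => //.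
  rewrite (_ : (fun _ => _) = \1_`[1 / 2, +oo[%classic).
    by apply: measurable_indic; exact: measurable_itv.
  by apply/funext => r; rewrite indicE; congr (_%:R); rewrite mem_setE in_itv/= andbT.
have mit : measurable_fun setT (iter k ternary_shift : measurableTypeR R -> R).
  elim: k => [|k ih]; first exact: measurable_id.
  by apply: (measurableT_comp mshift).
rewrite (_ : [set _ | _] = iter k ternary_shift @^-1` `[1 / 2, +oo[).
  by rewrite -[X in measurable X]setTI; apply: mit => //; exact: measurable_itv.
by apply/seteqP; split => r; rewrite /= in_itv/= andbT.
Qed.

End ternary_coding.

Section quantile.
Context (R : realType) (m : probability (measurableTypeR R) R).
Hypothesis m01 : m `[0, 1]%classic = 1%E.

Let F r : R := fine (m `]-oo, r]%classic).

Let FE r : (F r)%:E = m `]-oo, r]%classic.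
Proof. by rewrite fineK// fin_num_measure//; exact: measurable_itv. Qed.

Let F_nd r s : r <= s -> F r <= F s.
Proof.
move=> rs; rewrite -lee_fin !FE le_measure// ?inE; [exact: measurable_itv..|].
by move=> x /=; rewrite !in_itv/= => /le_trans; exact.
Qed.

Let F_le1 r : F r <= 1.
Proof. by rewrite -lee_fin FE probability_le1//; exact: measurable_itv. Qed.

Let F1 r : 1 <= r -> F r = 1.
Proof.
move=> r1; apply/le_anti; rewrite F_le1/= -lee_fin FE -m01.
apply: le_measure; rewrite ?inE; [exact: measurable_itv..|].
by move=> x /=; rewrite !in_itv/= => /andP[_ /le_trans]; exact.
Qed.

Let F_rc r t : F r < t -> exists2 s, r < s & F s < t.
Proof.
move=> rt.
pose id := (idfun : measurableTypeR R -> R).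
have mid : measurable_fun setT id by exact: measurable_id.
pose X : {RV m >-> R} := mfun_of mid.
have FX s : cdf X s = (F s)%:E by rewrite FE.
have := @cdf_right_continuous _ _ _ m X r; rewrite FX => FXr.
have /FXr : nbhs (F r)%:E [set y | y < t%:E]%E by exact: lt_nbhsl.
move=> H.
have {}H : \forall s \near r^'+, (cdf X s < t%:E)%E by exact: H.
near (r^'+) => s; exists s; first by near: s; exact: nbhs_right_gt.
by rewrite -lte_fin -FX; near: s.
Unshelve. all: by end_near. Qed.

(** The clause 1 <= r makes the set nonempty for every s, so that q is
    monotone on the whole line, hence Borel. *)
Let Q s : set R := [set r | 0 <= r /\ (s <= F r \/ 1 <= r)].
Let q s : R := inf (Q s).

Let Qlb s : has_lbound (Q s). Proof. by exists 0 => r []. Qed.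

Let Q0 s : Q s !=set0. Proof. by exists 1; split; [exact: ler01|right]. Qed.

Let mq : measurable_fun setT (q : measurableTypeR R -> measurableTypeR R).
Proof.
apply: nondecreasing_measurable => // s t st.
apply: lb_le_inf => // r [r0 tr]; apply: ge_inf => //; split => //.
by case: tr => [tF|]; [left; rewrite (le_trans st)|right].
Qed.

Let q_gt r s : 0 <= r -> 0 <= s <= 1 -> (r < q s) = (F r < s).
Proof.
move=> r0 /andP[s0 s1]; apply/idP/idP => [rq|Fs].
  rewrite ltNge; apply/negP => sF; move: rq; apply/negP; rewrite -leNgt.
  by apply: ge_inf => //; split => //; left.
have r1 : r < 1.
  by rewrite ltNge; apply/negP => /F1 Fr1; move: Fs; rewrite Fr1 ltNge s1.
have [t rt Ft] := F_rc Fs.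
apply: (@lt_le_trans _ _ (Num.min t 1)); first by rewrite lt_min rt.
apply: lb_le_inf => // u [u0 [sFu|u1]]; rewrite ge_min ?u1 ?orbT//.
rewrite leNgt; apply/orP; left; apply/negP => ut.
by have := F_nd (ltW ut); rewrite leNgt (lt_le_trans Ft).
Qed.

(** The quantile function q of m satisfies r < q s iff F r < s, for r >= 0 and s
    in [0, 1], where F is the distribution function; so q sends Lebesgue measure
    on [0, 1] to m. *)
Lemma quantile_transform : exists2 q : measurableTypeR R -> measurableTypeR R,
  measurable_fun setT q & forall A, measurable A -> m A = unif R (q @^-1` A).
Proof.
exists q => // A mA.
pose mq' : {measure set (measurableTypeR R) -> \bar R} :=
  distribution (unif R) (mfun_of mq).
suff : m A = mq' A by [].
apply: (@measure_unique _ R (measurableTypeR R) (@RGenOInfty.G R)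
  (fun n => `]- n%:R, +oo[%classic) _ _ _ _ m mq') => //.
- exact: RGenOInfty.measurableE.
- move=> _ _ [x ->] [y ->]; exists (Num.max x y).
  by apply/seteqP; split => z /=; rewrite !in_itv/= !andbT gt_max => /andP.
- by move=> n; exists (- n%:R).
- rewrite -subTset => x _; have [n nx] : exists n, - x < n%:R.
    by exists (Num.truncn (- x)).+1; rewrite truncnS_gt.
  by exists n => //=; rewrite in_itv/= andbT ltrNl.
- move=> _ [r ->].
  have [r0|r0] := ltP r 0.
    transitivity (1%E : \bar R).
      apply/eqP; rewrite eq_le; apply/andP; split.
        by apply: (@probability_le1 _ _ _ m); exact: measurable_itv.
      rewrite -m01; apply: le_measure; rewrite ?inE; [exact: measurable_itv..|].
      by move=> x /=; rewrite !in_itv/= andbT => /andP[+ _]; exact: lt_le_trans.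
    rewrite -(@probability_setT _ _ _ (unif R)); congr (unif R _).
    apply/esym; rewrite -subTset => s _ /=; rewrite in_itv/= andbT.
    by apply: (lt_le_trans r0); apply: lb_le_inf => // ? [].
  transitivity (1 - (F r)%:E)%E.
    rewrite FE -probability_setC; last exact: measurable_itv.
    by rewrite setCitvl.
  rewrite /mq' /= /distribution /pushforward /unif /mrestr.
  rewrite (_ : _ `&` _ = `]F r, 1]%classic).
    rewrite lebesgue_measure_itv/= lte_fin; case: ltP => [//|F1r].
    by rewrite (_ : F r = 1) ?subee//; apply/le_anti; rewrite F_le1.
  have Fr0 : 0 <= F r by rewrite fine_ge0.
  apply/seteqP; split => s /=; rewrite !in_itv/= andbT.
    by move=> [rq s01]; rewrite -q_gt// rq; case/andP: s01.
  move=> /andP[Fs s1]; have s01 : 0 <= s <= 1 by rewrite s1 (le_trans Fr0 (ltW Fs)).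
  by rewrite q_gt.
- move=> k; rewrite (le_lt_trans _ (ltry 1))// probability_le1//.
Qed.

End quantile.

(** A measurable space is coded when its points can be recovered, in a
    measurable way, from their traces on countably many measurable sets.  This
    is the part of being standard Borel which parametrisations require; it is
    stable under products. *)
Definition coded (R : realType) d (T : measurableType d) :=
  exists (B : nat -> set T) (c : (nat -> bool) -> T),
  [/\ forall k, measurable (B k),
      forall t, c (fun k => `[< B k t >]) = t &
      forall b : measurableTypeR R -> nat -> bool,
        (forall k, measurable [set s | b s k]) -> measurable_fun setT (c \o b)].

Lemma coded_prod (R : realType) d1 d2 (T1 : measurableType d1)
    (T2 : measurableType d2) :
  coded R T1 -> coded R T2 -> coded R (T1 * T2)%type.
Proof.
move=> [B1 [c1 [mB1 cB1 mc1]]] [B2 [c2 [mB2 cB2 mc2]]].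
exists (fun k => if odd k then setT `*` B2 k./2 else B1 k./2 `*` setT).
exists (fun b => (c1 (fun k => b k.*2), c2 (fun k => b k.*2.+1))); split.
- by move=> k; case: ifP => _; exact: measurableX.
- move=> [t1 t2]; congr (_, _).
    rewrite -[RHS]cB1; congr c1; apply/funext => k; apply/asbool_equiv_eq.
    by rewrite odd_double doubleK/=; split => [[]|].
  rewrite -[RHS]cB2; congr c2; apply/funext => k; apply/asbool_equiv_eq.
  by rewrite /= odd_double/= uphalf_double; split => [[]|].
- move=> b mb; apply/prod_measurable_funP; split.
    by apply: (mc1 (fun s k => b s k.*2)) => k; exact: mb.
  by apply: (mc2 (fun s k => b s k.*2.+1)) => k; exact: mb.
Qed.

(** The traces of a point on the coding sets are the ternary digits of a real
    number, which depends measurably on the point; the quantile function of its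
    law, followed by digit extraction and decoding, is the parametrisation. *)
Lemma coded_parametrisation (R : realType) d (T : measurableType d)
    (P : probability T R) : coded R T ->
  exists2 chi : measurableTypeR R -> T, measurable_fun setT chi &
    forall A, measurable A -> P A = unif R (chi @^-1` A).
Proof.
move=> [B [c [mB cB mc]]].
pose e t : measurableTypeR R := ternary R (fun k => `[< B k t >]).
have me : measurable_fun setT e.
  apply: (measurable_fun_cvg (h := fun n t => ternary_sum R (fun k => `[< B k t >]) n)).
    move=> n; apply: measurable_sum => k; apply: measurable_funM => //.
    apply: measurable_funM => //.
    rewrite (_ : (fun _ => _) = \1_(B k)); first exact: measurable_indic.
    by apply/funext => t; rewrite indicE; congr (nat_of_bool _)%:R.
  by move=> t _; exact: cvg_ternary.
pose m : probability (measurableTypeR R) R := distribution P (mfun_of me).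
have m01 : m `[0, 1]%classic = 1%E.
  rewrite -(probability_setT P); congr (P _).
  by rewrite -subTset => t _ /=; rewrite in_itv/=; exact: ternary_le1.
have [q mq qm] := quantile_transform m01.
pose dec r := c (@ternary_digit R r).
have mdec : measurable_fun setT (dec : measurableTypeR R -> T).
  by apply: mc => k; exact: measurable_ternary_digit.
have decK t : dec (e t) = t.
  by rewrite /dec -[RHS]cB; congr c; apply/funext => k; rewrite ternary_digitK.
exists (dec \o q); first exact: measurableT_comp.
move=> A mA; rewrite comp_preimage -qm.
  by congr (P _); apply/funext => t /=; rewrite decK.
by rewrite -[X in measurable X]setTI; exact: mdec.
Qed.

Section polish_coded.
Context (R : realType) (X : completeMetricType R).

Lemma cvg_mdist_geometric (u : nat -> X) :
  (forall n, mdist (u n) (u n.+1) <= 2 * 2^-1 ^+ n) -> cvgn u.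
Proof.
move=> du.
have dun n k : mdist (u n) (u (n + k)%N) <= 4 * 2^-1 ^+ n - 4 * 2^-1 ^+ (n + k).
  elim: k => [|k ih]; first by rewrite addn0 mdistxx subrr.
  rewrite addnS (le_trans (metric_triangle _ (u (n + k)%N) _))//.
  by have := du (n + k)%N; rewrite [_ ^+ (n + k).+1]exprS; lra.
apply/cauchy_cvgP; apply: cauchy_exP => e e0.
have [N Ne] : exists N, 4 * 2^-1 ^+ N < e.
  have : (fun n => 4 * 2^-1 ^+ n : R) @ \oo --> (0 : R).
    rewrite -[X in _ --> X](mulr0 4); apply: cvgMr.
    by apply: cvg_expr; rewrite ger0_norm; lra.
  move=> /cvgrPdist_lt/(_ _ e0)[N _ /(_ N (leqnn N))].
  rewrite sub0r normrN ger0_norm; first by exists N.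
  by rewrite mulr_ge0// exprn_ge0.
exists (u N); exists N => // n /= Nn; rewrite ballEmdist/=.
rewrite -(subnKC Nn) (le_lt_trans (dun _ _))// (le_lt_trans _ Ne)//.
by rewrite gerBl mulr_ge0// exprn_ge0.
Qed.

Lemma cvg_mdist (u : nat -> X) (x y : X) : u @ \oo --> y ->
  (fun n => mdist x (u n)) @ \oo --> mdist x y.
Proof.
move=> uy; apply/cvgrPdist_le => e e0.
near=> n; have h : mdist y (u n) <= e.
  by near: n; apply: metricType_numDomainType.cvgr_dist_le.
have := metric_triangle x y (u n); have := metric_triangle x (u n) y.
by rewrite [mdist (u n) y]metric_sym ler_distl => *; apply/andP; split; lra.
Unshelve. all: by end_near. Qed.

Definition mlevel d (T : measurableType d) (f : T -> nat) :=
  forall j, measurable [set t | f t = j].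

Lemma mlevel2 d (T : measurableType d) (f g : T -> nat) (h : nat -> nat -> nat) :
  mlevel f -> mlevel g -> mlevel (fun t => h (f t) (g t)).
Proof.
move=> mf mg j.
rewrite (_ : [set t | _] = \bigcup_a \bigcup_(b in [set b | h a b = j])
  ([set t | f t = a] `&` [set t | g t = b])).
  apply: bigcupT_measurable => a; apply: bigcup_measurable => b _.
  exact: measurableI.
apply/seteqP; split => [t /= ht|t [a _ [b /= <- [<- <-]]]//].
by exists (f t) => //; exists (g t).
Qed.

Lemma mlevel_comp d (T : measurableType d) (f : T -> nat) (h : nat -> R) :
  mlevel f -> measurable_fun setT (h \o f).
Proof.
move=> mf _ A mA; rewrite setTI.
rewrite (_ : _ @^-1` _ = \bigcup_(a in [set a | A (h a)]) [set t | f t = a]).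
  by apply: bigcup_measurable.
by apply/seteqP; split => [t /= ht|t [a /= Aa fa]]; [exists (f t)|rewrite /= fa].
Qed.

Definition least (p : nat -> bool) : nat :=
  if pselect (exists n, p n) is left e then ex_minn e else 0%N.

Lemma leastP (p : nat -> bool) : (exists n, p n) -> p (least p).
Proof. by rewrite /least; case: pselect => // e _; case: ex_minnP. Qed.

Lemma mlevel_least d (T : measurableType d) (p : T -> nat -> bool) :
  (forall n, measurable [set t | p t n]) -> mlevel (fun t => least (p t)).
Proof.
move=> mp.
have mS j : measurable [set t | least (p t) = j.+1].
  rewrite (_ : [set _ | _] = [set t | p t j.+1] `&`
      \bigcap_(i in [set i | (i < j.+1)%N]) ~` [set t | p t i]).
    apply: measurableI => //; apply: bigcap_measurable => [|i _]; first by exists 0%N.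
    exact: measurableC.
  rewrite /least; apply/seteqP; split => t /=.
    case: pselect => // e; case: ex_minnP => n pn nmin nj; subst n; split => //.
    by move=> i /= ij pi; have := nmin _ pi; rewrite leqNgt ij.
  move=> [pj ltj]; case: pselect => [e|]; last by case; exists j.+1.
  case: ex_minnP => n pn nmin; apply/eqP; rewrite eqn_leq nmin//= leqNgt.
  by apply/negP => nj; exact: (ltj n).
case=> [|j]; last exact: mS.
rewrite (_ : [set _ | _] = ~` \bigcup_j [set t | least (p t) = j.+1]).
  by apply: measurableC; exact: bigcupT_measurable.
apply/seteqP; split => [t /= t0 [j _ /=]|t /= tj]; first by rewrite t0.
by case E: (least _) => [//|j]; exfalso; apply: tj; exists j.
Qed.

(** Points are coded by the balls of radius 2^-m around a dense sequence z that
    contain them.  To decode, choose at each level m a ball in the list, and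
    keep the previous centre when the new one is too far from it: the centres
    then always form a Cauchy sequence, so that the limit exists for every code
    and not only for codes of points. *)
Lemma coded_metric : separable X -> coded R (borel X).
Proof.
move=> /dense_seq[z dz].
pose ctr (b : nat -> bool) (m : nat) := least (fun n : nat => b (pickle (m, n))).
pose near_ m i j := if mdist (z i) (z j) <= 2 * 2^-1 ^+ m then j else i.
pose fix w (b : nat -> bool) (m : nat) : nat :=
  if m is m'.+1 then near_ m' (w b m') (ctr b m) else ctr b 0%N.
pose c b : borel X := lim ((z \o w b) @ \oo).
have wc b : (z \o w b) @ \oo --> (c b : X).
  apply: cvg_mdist_geometric => n /=; rewrite /near_.
  by case: ifP => //; rewrite mdistxx mulr_ge0// exprn_ge0.
pose B k : set (borel X) := if unpickle k is Some (m, n) then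
  [set x : X | mdist (z n) x < 2^-1 ^+ m] else set0.
exists B, c; split.
- by move=> k; rewrite /B; case: unpickle => [[m n]|//]; exact: borel_ball.
- move=> x; set b := fun k => _.
  have zx m : mdist (z (ctr b m)) x < 2^-1 ^+ m.
    have ex : exists n : nat, b (pickle (m, n)).
      have m0 : (0 < 2^-1 ^+ m :> R) by rewrite exprn_gt0.
      have [n nx] := dz x _ m0; exists n; apply/asboolP.
      by rewrite /B pickleK.
    by have /asboolP := leastP ex; rewrite /B pickleK.
  (* Centres of balls containing x are close enough to each other to be kept. *)
  have wE m : w b m = ctr b m.
    elim: m => //= m ih; rewrite /near_ ih ifT//.
    have := metric_triangle (z (ctr b m)) x (z (ctr b m.+1)).
    have := zx m; have := zx m.+1; rewrite exprS [mdist x _]metric_sym.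
    have : (0 < 2^-1 ^+ m :> R) by rewrite exprn_gt0.
    by lra.
  apply/cvg_lim; first exact: metric_hausdorff.
  apply/metricType_numDomainType.cvgrPdist_lt => e e0.
  have : (fun n => 2^-1 ^+ n : R) @ \oo --> (0 : R).
    by apply: cvg_expr; rewrite ger0_norm; lra.
  move=> /cvgrPdist_lt/(_ _ e0)[N _ Ne]; exists N => // n /= /Ne.
  rewrite sub0r normrN ger0_norm ?exprn_ge0// => /(lt_trans _); apply.
  by rewrite wE metric_sym.
- move=> b mb; apply: (measurable_fun_into dz) => n.
  apply: (measurable_fun_cvg (h := fun m s => mdist (z n) (z (w (b s) m)))).
    move=> m; apply: (@mlevel_comp _ _ (fun s => w (b s) m) (fun i => mdist (z n) (z i))).
    elim: m => [|m ih] /=; first by apply: mlevel_least.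
    by apply: mlevel2 => //; apply: mlevel_least.
  by move=> s _; apply: cvg_mdist; exact: wc.
Qed.

End polish_coded.

(** * Transport of finite masses along a relation *)

Section finite_transport.
Context (R : realType) (I J : finType).
Implicit Types (p : I -> R) (q : J -> R) (E : I -> J -> bool).

Definition neighbours E (S : {set I}) : {set J} :=
  [set j | [exists i in S, E i j]].

Lemma neighbours1 E i j : (j \in neighbours E [set i]) = E i j.
Proof.
rewrite inE; apply/existsP/idP => [[k /andP[/set1P ->]]//|ij].
by exists i; rewrite set11.
Qed.

Lemma neighboursU E (S T : {set I}) : neighbours E (S :|: T) = neighbours E S :|: neighbours E T.
Proof.
apply/setP => j; rewrite !inE; apply/existsP/orP => [[i]|[] /existsP[i /andP[iS ij]]].
- by rewrite inE => /andP[/orP[iS|iT] ij]; [left|right]; apply/existsP; exists i; apply/andP.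
- by exists i; rewrite inE iS.
- by exists i; rewrite inE iS orbT.
Qed.

Lemma neighboursS E (S T : {set I}) : S \subset T -> neighbours E S \subset neighbours E T.
Proof. by move=> /finset.setUidPr <-; rewrite neighboursU finset.subsetUl. Qed.

Definition hall p q E :=
  forall S : {set I}, \sum_(i in S) p i <= \sum_(j in neighbours E S) q j.

Definition transport p q E (w : I -> J -> R) :=
  [/\ forall i j, 0 <= w i j, forall i j, ~~ E i j -> w i j = 0,
      forall i, \sum_j w i j = p i & forall j, \sum_i w i j <= q j].

Let spike (T : finType) (a : T) (t : R) x := if x == a then t else 0.

Let sum_spike (T : finType) (A : {set T}) a t :
  \sum_(x in A) spike a t x = if a \in A then t else 0.
Proof.
case: ifPn => aA; last first.
  by rewrite big1// => x xA; rewrite /spike; case: eqP => // xa; rewrite -xa xA in aA.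
by rewrite (bigD1 a)//= /spike eqxx big1 ?addr0// => x /andP[_ /negPf ->].
Qed.

Let sum_restrict (T : finType) (A B : {set T}) (f : T -> R) :
  \sum_(x in A) (if x \in B then f x else 0) = \sum_(x in A :&: B) f x.
Proof. by rewrite -big_mkcondr; apply: eq_bigl => x; rewrite inE. Qed.

Lemma transport_add p p1 p2 q q1 q2 E w1 w2 :
  (forall i, p i = p1 i + p2 i) -> (forall j, q1 j + q2 j <= q j) ->
  transport p1 q1 E w1 -> transport p2 q2 E w2 ->
  transport p q E (fun i j => w1 i j + w2 i j).
Proof.
move=> pE qE [a1 b1 c1 d1] [a2 b2 c2 d2]; split => [i j|i j nij|i|j].
- exact: addr_ge0.
- by rewrite b1// b2// addr0.
- by rewrite big_split/= c1 c2.
- by rewrite big_split/= (le_trans _ (qE j))// lerD.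
Qed.

Lemma transport_spike E i j t : E i j -> 0 <= t ->
  transport (spike i t) (spike j t) E (fun k l => spike i (spike j t l) k).
Proof.
move=> ij t0; split => [k l|k l|k|l]; rewrite /spike.
- by case: ifP => // _; case: ifP.
- by case: eqP => [->|//]; case: eqP => [->|//]; rewrite ij.
- case: ifP => [_|ki]; last by rewrite big1.
  by rewrite -big_mkcond big_pred1_eq.
- by rewrite -big_mkcond big_pred1_eq.
Qed.

(** A tight set S forces all the mass at its neighbours to come from S, and
    Hall's condition is inherited by S and by its complement. *)
Lemma hall_split p q E (S : {set I}) : (forall j, 0 <= q j) -> hall p q E ->
  \sum_(i in S) p i = \sum_(j in neighbours E S) q j ->
  hall (fun i => if i \in S then p i else 0)
       (fun j => if j \in neighbours E S then q j else 0) E /\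
  hall (fun i => if i \in ~: S then p i else 0)
       (fun j => if j \in ~: neighbours E S then q j else 0) E.
Proof.
move=> q0 hE tight; split => T; rewrite !sum_restrict.
  have sub : neighbours E (T :&: S) \subset neighbours E T :&: neighbours E S.
    by rewrite finset.subsetI !neighboursS// ?finset.subsetIl ?finset.subsetIr.
  apply: (le_trans (hE _)); rewrite [leRHS](big_setID (neighbours E (T :&: S)))/=.
  by rewrite (finset.setIidPr sub) lerDl sumr_ge0.
have := hE (S :|: T).
rewrite neighboursU (big_setID S) [leRHS](big_setID (neighbours E S)) /=.
by rewrite !finset.setUK tight lerD2l !finset.setDUl !finset.setDv !finset.set0U !finset.setDE.
Qed.

Let positive (T : finType) (f : T -> R) : {set T} := [set x | 0 < f x]%SET.

Let support_card p q := (#|positive p| + #|positive q|)%N.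

(** The weighted form of Hall's marriage theorem.  Send from a point i to a
    neighbour j as much mass as Hall's condition allows.  Then either i or j is
    exhausted, or some set has become tight and the problem splits into two;
    in each case fewer points carry mass. *)
Lemma hall_transport p q E : (forall i, 0 <= p i) -> (forall j, 0 <= q j) ->
  hall p q E -> exists w, transport p q E w.
Proof.
have [n] := ubnP (support_card p q); elim: n => // n ih in p q *.
rewrite ltnS => cn p0 q0 hE.
have [[i pi]|pN] := pselect (exists i, 0 < p i); last first.
  have pE i : p i = 0.
    by apply/le_anti; rewrite p0 andbT leNgt; apply/negP => pi; apply: pN; exists i.
  exists (fun _ _ => 0); split => // [i|j]; first by rewrite big1.
  by rewrite big1.
have [j ij qj] : exists2 j, E i j & 0 < q j.
  apply: contrapT => nj; have := hE [set i]%SET; rewrite big_set1 leNgt => /negP; apply.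
  rewrite big1// => j; rewrite neighbours1 => ij; apply/le_anti; rewrite q0 andbT leNgt.
  by apply/negP => qj; apply: nj; exists j.
pose P (S : {set I}) := (i \notin S) && (j \in neighbours E S).
pose slack (S : {set I}) := \sum_(l in neighbours E S) q l - \sum_(k in S) p k.
(* The largest mass that can go from i to j without breaking Hall's condition
   for the sets that do not contain i but have j among their neighbours. *)
pose t := \big[Num.min/Num.min (p i) (q j)]_(S : {set I} | P S) slack S.
have t0 : 0 <= t.
  by apply/bigmin_geP; split => [|S _]; rewrite ?le_min ?p0 ?q0 ?subr_ge0.
have /andP[tp tq] : (t <= p i) && (t <= q j) by rewrite -le_min bigmin_le_id.
have ts S : P S -> t <= slack S by move=> PS; exact: bigmin_le_cond.
pose p' k := p k - spike i t k; pose q' l := q l - spike j t l.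
have p'0 k : 0 <= p' k by rewrite /p' /spike; case: eqP => [->|_]; rewrite subr_ge0.
have q'0 l : 0 <= q' l by rewrite /q' /spike; case: eqP => [->|_]; rewrite subr_ge0.
have sp' (S : {set I}) :
    \sum_(k in S) p' k = \sum_(k in S) p k - if i \in S then t else 0.
  by rewrite sumrB sum_spike.
have sq' (S : {set J}) :
    \sum_(l in S) q' l = \sum_(l in S) q l - if j \in S then t else 0.
  by rewrite sumrB sum_spike.
have hE' : hall p' q' E.
  move=> S; rewrite sp' sq'; have := hE S; case: ifPn => iS.
    have -> : j \in neighbours E S by rewrite inE; apply/existsP; exists i; rewrite iS.
    lra.
  by case: ifPn => jS; [have := ts S; rewrite /P iS jS /slack => /(_ isT)|]; lra.
have p'p k : 0 < p' k -> 0 < p k.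
  by rewrite /p' /spike; case: ifP => _ ?; lra.
have q'q l : 0 < q' l -> 0 < q l.
  by rewrite /q' /spike; case: ifP => _ ?; lra.
have sub1 : positive p' \subset positive p.
  by apply/fintype.subsetP => k; rewrite !inE; exact: p'p.
have sub2 : positive q' \subset positive q.
  by apply/fintype.subsetP => l; rewrite !inE; exact: q'q.
suff [w' hw'] : exists w', transport p' q' E w'.
  eexists; apply: (transport_add _ _ hw' (transport_spike ij t0)) => k.
    by rewrite /p' subrK.
  by rewrite /q' subrK.
have [pi'|pi'] := leP (p' i) 0.
  apply: ih => //; apply: leq_trans cn; rewrite -addSn leq_add ?subset_leq_card//.
  apply: proper_card; rewrite fintype.properE sub1; apply/fintype.subsetPn; exists i; rewrite inE//.
  by rewrite -leNgt.
have [qj'|qj'] := leP (q' j) 0.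
  apply: ih => //; apply: leq_trans cn; rewrite -addnS leq_add ?subset_leq_card//.
  apply: proper_card; rewrite fintype.properE sub2; apply/fintype.subsetPn; exists j; rewrite inE//.
  by rewrite -leNgt.
have [S PS tS] : exists2 S, P S & t = slack S.
  apply: contrapT => nS; suff : t < t by rewrite ltxx.
  apply/bigmin_gtP; split => [|S PS].
    by rewrite lt_min; move: pi' qj'; rewrite /p' /q' /spike !eqxx !subr_gt0 => -> ->.
  by rewrite lt_neqAle ts// andbT; apply/eqP => tS; apply: nS; exists S.
have /andP[iS jS] := PS.
have tight : \sum_(k in S) p' k = \sum_(l in neighbours E S) q' l.
  by rewrite sp' sq' jS (negPf iS) tS /slack; lra.
have [h1 h2] := hall_split q'0 hE' tight.
have [|||w1 hw1] := ih _ _ _ _ _ h1; [|by move=> ?; case: ifP..|].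
  apply: leq_trans cn; rewrite -addSn leq_add//.
    apply: proper_card; apply/fintype.properP; split.
      by apply/fintype.subsetP => k; rewrite !inE; case: ifP; rewrite ?ltxx// => _; exact: p'p.
    by exists i; rewrite inE// (negPf iS) ltxx.
  apply/subset_leq_card/fintype.subsetP => l; rewrite !inE; case: ifP; rewrite ?ltxx// => _.
  exact: q'q.
have [|||w2 hw2] := ih _ _ _ _ _ h2; [|by move=> ?; case: ifP..|].
  apply: leq_trans cn; rewrite -addnS leq_add//.
    apply/subset_leq_card/fintype.subsetP => k; rewrite !inE; case: ifP; rewrite ?ltxx// => _.
    exact: p'p.
  apply: proper_card; apply/fintype.properP; split.
    by apply/fintype.subsetP => l; rewrite !inE; case: ifP; rewrite ?ltxx// => _; exact: q'q.
  by exists j; rewrite inE// [_ \in ~: _]inE jS ltxx.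
eexists; apply: (transport_add _ _ hw1 hw2) => [k|l].
  by rewrite inE; case: (k \in S); rewrite ?addr0 ?add0r.
by rewrite [_ \in ~: _]inE; case: (l \in neighbours E S); rewrite ?addr0 ?add0r.
Qed.

End finite_transport.

Section hall_coupling.
Context (R : realType) (I J : finType).

(** An additional point of J, of mass eps and related to every point of I,
    absorbs the deficiency in Hall's condition.  The mass it receives is then distributed
    among the points of J that are not saturated. *)
Lemma hall_coupling (p : I -> R) (q : J -> R) (E : I -> J -> bool) (eps : R) :
  (forall i, 0 <= p i) -> (forall j, 0 <= q j) -> 0 <= eps ->
  \sum_i p i = \sum_j q j ->
  (forall S : {set I},
     \sum_(i in S) p i <= \sum_(j in neighbours E S) q j + eps) ->
  exists w : I -> J -> R,
  [/\ forall i j, 0 <= w i j, forall i, \sum_j w i j = p i,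
      forall j, \sum_i w i j = q j &
      \sum_i \sum_(j | ~~ E i j) w i j <= eps].
Proof.
move=> p0 q0 eps0 pq hE.
pose q' (o : option J) := if o is Some j then q j else eps.
pose E' i (o : option J) := if o is Some j then E i j else true.
have q'0 o : 0 <= q' o by case: o.
have hE' : hall p q' E'.
  move=> S; have [->|/set0Pn[i iS]] := eqVneq S finset.set0.
    by rewrite big_set0 sumr_ge0.
  apply: (le_trans (hE S)); rewrite (bigD1 None)/=; last first.
    by rewrite inE; apply/existsP; exists i; rewrite iS.
  rewrite [leRHS]addrC lerD2r [leRHS](reindex_omap Some id)/=; last by case=> [?|]; rewrite ?andbF.
  rewrite le_eqVlt; apply/orP; left; apply/eqP/eq_bigl => j.
  by rewrite eqxx !andbT !inE.
have [w' [w0 wE wp wq]] := hall_transport p0 q'0 hE'.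
pose r i := w' i None; pose s := \sum_i r i.
have rowE i : \sum_j w' i (Some j) = p i - r i.
  rewrite -wp (bigD1 None)//= addrC addrK [RHS](reindex_omap Some id)/=; last by case.
  by apply: eq_bigl => j; rewrite eqxx.
(* What j still lacks; the total is what the additional point receives. *)
pose c j := q j - \sum_i w' i (Some j).
have c0 j : 0 <= c j by rewrite subr_ge0; exact: wq (Some j).
have r0 i : 0 <= r i by exact: w0.
have sc : \sum_j c j = s.
  rewrite sumrB exchange_big/= (eq_bigr _ (fun i _ => rowE i)) sumrB -pq.
  by rewrite opprB addrC subrK.
have [s0|sn0] := eqVneq s 0.
  have ri0 i : r i = 0.
    by apply: (psumr_eq0P (P := xpredT) (F := r)) => //.
  have cj0 j : c j = 0.
    by apply: (psumr_eq0P (P := xpredT) (F := c)) => //; rewrite sc.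
  exists (fun i j => w' i (Some j)); split => // [i|j|].
  - by rewrite rowE ri0 subr0.
  - by have := cj0 j; rewrite /c => /eqP; rewrite subr_eq0 => /eqP.
  - by rewrite big1// => i _; rewrite big1// => j nE; rewrite wE.
exists (fun i j => w' i (Some j) + r i * c j / s); split => [i j|i|j|].
- by rewrite addr_ge0// divr_ge0 ?mulr_ge0// sumr_ge0.
- by rewrite big_split/= rowE -mulr_suml -mulr_sumr sc mulfK// subrK.
- rewrite big_split/= -mulr_suml -mulr_suml -/s [s * _]mulrC mulfK//.
  by rewrite /c addrC subrK.
- apply: (@le_trans _ _ s); last by exact: wq None.
  rewrite /s; apply: ler_sum => i _.
  under eq_bigr => j nE do rewrite wE// add0r.
  rewrite -[leRHS](mulfK sn0) -{1}sc mulr_sumr mulr_suml.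
  rewrite [leRHS](bigID (fun j => ~~ E i j))/= lerDl sumr_ge0// => j _.
  by rewrite divr_ge0 ?mulr_ge0// sumr_ge0.
Qed.

End hall_coupling.

(** * Couplings bound Gromov's metric from above *)

Section fibers.
Context d (T : measurableType d) (R : realType) (K : finType) (k : T -> K).
Hypothesis mk : forall i, measurable [set t | k t = i].

Let mfiber_seq (s : seq K) : measurable [set t | k t \in s].
Proof.
elim: s => [|i s ih].
  by rewrite (_ : [set _ | _] = set0)//; apply/seteqP; split.
rewrite (_ : [set _ | _] = [set t | k t = i] `|` [set t | k t \in s]).
  exact: measurableU.
apply/seteqP; split => t /=; rewrite inE.
  by move=> /orP[/eqP ->|]; [left|right].
by move=> [->|->]; rewrite ?eqxx ?orbT.
Qed.

Lemma measurable_fiber (A : {pred K}) : measurable [set t | k t \in A].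
Proof.
rewrite (_ : [set _ | _] = [set t | k t \in enum A])//.
by apply/seteqP; split => t /=; rewrite mem_enum.
Qed.

Lemma measure_fiber (mu : {measure set T -> \bar R}) (B : set T) (A : {pred K}) :
  measurable B ->
  mu (B `&` [set t | k t \in A]) = (\sum_(i in A) mu (B `&` [set t | k t = i]))%E.
Proof.
move=> mB; rewrite -big_enum/= (_ : [set _ | _] = [set t | k t \in enum A]); last first.
  by apply/seteqP; split => t /=; rewrite mem_enum.
elim: (enum A) (enum_uniq A) => [_|i s ih /= /andP[ni us]].
  by rewrite big_nil (_ : [set _ | _] = set0) ?setI0//; apply/seteqP; split.
rewrite big_cons -ih// -measureU.
- congr (mu _); rewrite -setIUr; congr (_ `&` _).
  apply/seteqP; split => t /=; rewrite inE.
    by move=> /orP[/eqP ->|]; [left|right].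
  by move=> [->|->]; rewrite ?eqxx ?orbT.
- exact: measurableI.
- exact: measurableI.
- apply/seteqP; split => // t [[_ /= ti] [_ /= ts]].
  by move: ni; rewrite -ti ts.
Qed.

Lemma measure_fiber_setT (mu : {measure set T -> \bar R}) (B : set T) :
  measurable B -> mu B = (\sum_i mu (B `&` [set t | k t = i]))%E.
Proof.
move=> mB; rewrite -(measure_fiber mu xpredT mB); congr (mu _).
by apply/seteqP; split => [t Bt|t []].
Qed.

End fibers.

Section finite_coupling.
Context (R : realType) d1 d2 (T1 : measurableType d1) (T2 : measurableType d2).
Context (mu : probability T1 R) (nu : probability T2 R).
Context (I J : finType) (k : T1 -> I) (l : T2 -> J) (w : I -> J -> R).
Hypotheses (mk : forall i, measurable [set t | k t = i])
           (ml : forall j, measurable [set t | l t = j]).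

Let p i : R := fine (mu [set t | k t = i]).
Let q j : R := fine (nu [set t | l t = j]).

Hypotheses (w0 : forall i j, 0 <= w i j)
  (wp : forall i, \sum_j w i j = p i) (wq : forall j, \sum_i w i j = q j).

Let p0 i : 0 <= p i. Proof. exact: fine_ge0. Qed.
Let q0 j : 0 <= q j. Proof. exact: fine_ge0. Qed.

Let c (z : I * J) : {nonneg R} :=
  NngNum (divr_ge0 (w0 z.1 z.2) (mulr_ge0 (p0 z.1) (q0 z.2))).

Let block (z : I * J) : set (T1 * T2) :=
  [set t | k t = z.1] `*` [set t | l t = z.2].

Let mblock z : measurable (block z).
Proof. exact: measurableX. Qed.

Let piece (n : nat) : {measure set (T1 * T2) -> \bar R} :=
  if insub n is Some o
  then mscale (c (enum_val (o : 'I_#|{: I * J}|)))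
         (mrestr (mu \x nu)%E (mblock (enum_val o)))
  else mzero.

Let coupling := msum piece #|{: I * J}|.

Let couplingE C :
  coupling C = (\sum_z (c z)%:num%:E * (mu \x nu)%E (C `&` block z))%E.
Proof.
rewrite /coupling /msum (reindex (@enum_val _ xpredT : 'I_#|{: I * J}| -> _))/=; last first.
  by exists enum_rank => z _; [exact: enum_valK|exact: enum_rankK].
by apply: eq_bigr => o _; rewrite /piece valK.
Qed.

Let couplingX A B : measurable A -> measurable B ->
  coupling (A `*` B) = (\sum_i \sum_j w i j / (p i * q j) *
    (fine (mu (A `&` [set t | k t = i])) * fine (nu (B `&` [set t | l t = j]))))%:E.
Proof.
move=> mA mB; rewrite couplingE pair_big -sumEFin; apply: eq_bigr => -[i j] _ /=.
have mAi : measurable (A `&` [set t | k t = i]) by exact: measurableI.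
have mBj : measurable (B `&` [set t | l t = j]) by exact: measurableI.
rewrite /block/= -setXI; have := product_measure1E mu nu mAi mBj => /= ->.
rewrite -(fineK (fin_num_measure mu _ mAi)) -(fineK (fin_num_measure nu _ mBj)).
by rewrite -!EFinM.
Qed.

(** A cell of mass 0 takes no part in w, so the default value of the division
    in c is harmless. *)
Let w_eq0l i j : p i = 0 -> w i j = 0.
Proof. by move=> pi0; apply: (psumr_eq0P (P := xpredT) (F := w i)) => //; rewrite wp. Qed.

Let w_eq0r i j : q j = 0 -> w i j = 0.
Proof.
by move=> qj0; apply: (psumr_eq0P (P := xpredT) (F := w ^~ j)) => //; rewrite wq.
Qed.

Let fine_le_measure d (T : measurableType d) (P : probability T R) A B :
  measurable A -> measurable B -> A `<=` B -> 0 <= fine (P A) <= fine (P B).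
Proof.
move=> mA mB AB; rewrite fine_ge0//= fine_le ?fin_num_measure//.
by apply: le_measure; rewrite ?inE.
Qed.

Let coupling_fst A : measurable A -> coupling (A `*` setT) = mu A.
Proof.
move=> mA; rewrite couplingX// (measure_fiber_setT mk mu mA) -sumEFin.
apply: eq_bigr => i _; have mAi : measurable (A `&` [set t | k t = i]).
  exact: measurableI.
rewrite -[RHS](fineK (fin_num_measure mu _ mAi)); congr (_%:E).
set a := fine _; have /andP[a0 ap] : 0 <= a <= p i by exact: fine_le_measure.
have [pi0|pi0] := eqVneq (p i) 0.
  rewrite big1 => [|j _]; last by rewrite w_eq0l// !mul0r.
  by apply/esym/le_anti; rewrite a0 -pi0 ap.
transitivity (\sum_j w i j * (a / p i)).
  apply: eq_bigr => j _; rewrite setTI -/(q j).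
  have [qj0|qj0] := eqVneq (q j) 0; first by rewrite w_eq0r// !mul0r.
  by rewrite -mulrA; congr (_ * _); rewrite invfM mulrACA mulVf// mulr1 mulrC.
by rewrite -mulr_suml wp mulrC divfK.
Qed.

Let coupling_snd B : measurable B -> coupling (setT `*` B) = nu B.
Proof.
move=> mB; rewrite couplingX// exchange_big/= (measure_fiber_setT ml nu mB) -sumEFin.
apply: eq_bigr => j _; have mBj : measurable (B `&` [set t | l t = j]).
  exact: measurableI.
rewrite -[RHS](fineK (fin_num_measure nu _ mBj)); congr (_%:E).
set b := fine _; have /andP[b0 bq] : 0 <= b <= q j by exact: fine_le_measure.
have [qj0|qj0] := eqVneq (q j) 0.
  rewrite big1 => [|i _]; last by rewrite w_eq0r// !mul0r.
  by apply/esym/le_anti; rewrite b0 -qj0 bq.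
transitivity (\sum_i w i j * (b / q j)).
  apply: eq_bigr => i _; rewrite setTI -/(p i).
  have [pi0|pi0] := eqVneq (p i) 0; first by rewrite w_eq0l// !mul0r.
  by rewrite -mulrA; congr (_ * _); rewrite invfM mulrACA mulVf// mul1r mulrC.
by rewrite -mulr_suml wq mulrC divfK.
Qed.

Let coupling_rel (E : I -> J -> bool) :
  coupling [set z | E (k z.1) (l z.2)] = (\sum_i \sum_(j | E i j) w i j)%:E.
Proof.
rewrite couplingE pair_big_dep/= -sumEFin [RHS]big_mkcond/=.
apply: eq_bigr => -[i j] _ /=; case: ifPn => Eij; last first.
  rewrite (_ : _ `&` _ = set0) ?measure0 ?mule0//.
  by apply/seteqP; split => // -[t s] /= [+ [ki lj]]; rewrite ki lj (negPf Eij).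
rewrite (_ : _ `&` _ = block (i, j)); last first.
  by apply/seteqP; split => [z [//]|[t s] /= [ki lj]]; rewrite ki lj.
have := product_measure1E mu nu (mk i) (ml j) => /= ->.
rewrite -(fineK (fin_num_measure mu _ (mk i))) -(fineK (fin_num_measure nu _ (ml j))).
rewrite -!EFinM -/(p i) -/(q j); congr (_%:E).
have [pi0|pi0] := eqVneq (p i) 0; first by rewrite w_eq0l// !mul0r.
have [qj0|qj0] := eqVneq (q j) 0; first by rewrite w_eq0r// !mul0r.
by rewrite divfK// mulf_neq0.
Qed.

Let coupling_setT : coupling setT = 1%E.
Proof. by rewrite -setXTT coupling_fst// probability_setT. Qed.

Let coupling_prob : probability (T1 * T2)%type R :=
  HB.pack (msum piece #|{: I * J}|)
    (Measure_isProbability.Build _ _ _ (msum piece #|{: I * J}|) coupling_setT).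

(** A transport plan between the masses of finitely many cells is realised by
    spreading the mass w i j over the product of the cells i and j
    proportionally to the product measure. *)
Lemma finite_coupling : exists pi : probability (T1 * T2)%type R,
  [/\ forall A, measurable A -> pi (A `*` setT) = mu A,
      forall B, measurable B -> pi (setT `*` B) = nu B &
      forall E : I -> J -> bool,
        pi [set z | E (k z.1) (l z.2)] = (\sum_i \sum_(j | E i j) w i j)%:E].
Proof. by exists coupling_prob; split. Qed.

End finite_coupling.

Section gromov_box_bounds.
Context (R : realType) (lambda : R) (lambda0 : 0 < lambda).
Implicit Types X Y : mmspace R.

Lemma inf_ge0 (S : set R) : (forall x, S x -> 0 <= x) -> 0 <= inf S.
Proof.
move=> S0; have [->|/set0P Sn] := eqVneq S set0; first by rewrite inf0.
exact: lb_le_inf.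
Qed.

Lemma box_lbound d (T : measurableType d) (D : set T) (mu : set T -> \bar R)
    (r s : T -> T -> R) :
  has_lbound [set e | 0 < e /\ exists A : set T,
        [/\ measurable A, A `<=` D,
            forall x y, A x -> A y -> `|r x y - s x y| <= e &
            (mu (D `\` A) <= (lambda * e)%:E)%E]].
Proof. by exists 0 => e [/ltW]. Qed.

Lemma box_ge0 d (T : measurableType d) (D : set T) (mu : set T -> \bar R)
    (r s : T -> T -> R) : 0 <= box D mu lambda r s.
Proof. by apply: inf_ge0 => e [/ltW]. Qed.

Lemma gromov_box_lbound X Y : has_lbound [set r |
  exists (phi : measurableTypeR R -> X) (psi : measurableTypeR R -> Y),
        [/\ parametrisation phi, parametrisation psi &
            r = box (@unit_interval R) (@lebesgue_measure R) lambda
                  (fun s t => mdist (phi s) (phi t))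
                  (fun s t => mdist (psi s) (psi t))]].
Proof. by exists 0 => _ [phi [psi [_ _ ->]]]; exact: box_ge0. Qed.

Lemma parametrisationP X (phi : measurableTypeR R -> X) :
  measurable_fun setT (phi : _ -> borel X) ->
  (forall A, measurable A -> mm_measure X A = unif R (phi @^-1` A)) ->
  parametrisation phi.
Proof.
move=> mphi hphi; split; first exact: measurable_funTS.
by move=> A mA; rewrite hphi// /unif /mrestr setIC.
Qed.

Lemma parametrisation_ex X : exists phi, parametrisation (X := X) phi.
Proof.
have [phi mphi hphi] := coded_parametrisation (mm_measure X)
  (coded_metric (mm_separable X)).
by exists phi; exact: parametrisationP.
Qed.

Lemma gromov_box_le X Y (phi : measurableTypeR R -> X)
    (psi : measurableTypeR R -> Y) (A : set (measurableTypeR R)) e :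
  parametrisation phi -> parametrisation psi -> 0 < e ->
  measurable A -> A `<=` @unit_interval R ->
  (forall s t, A s -> A t ->
    `|mdist (phi s) (phi t) - mdist (psi s) (psi t)| <= e) ->
  (lebesgue_measure (@unit_interval R `\` A) <= (lambda * e)%:E)%E ->
  gromov_box lambda X Y <= e.
Proof.
move=> pphi ppsi e0 mA AI hA lA.
apply: (@le_trans _ _ (box (@unit_interval R) (@lebesgue_measure R) lambda
  (fun s t => mdist (phi s) (phi t)) (fun s t => mdist (psi s) (psi t)))).
  by apply: ge_inf; [exact: gromov_box_lbound|exists phi, psi].
by apply: ge_inf; [exact: box_lbound|split => //; exists A].
Qed.

Lemma gromov_box_ltP X Y e : gromov_box lambda X Y < e ->
  exists (phi : measurableTypeR R -> X) (psi : measurableTypeR R -> Y)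
    (A : set (measurableTypeR R)) e',
  [/\ parametrisation phi, parametrisation psi, 0 < e' < e, 
      measurable A /\ A `<=` @unit_interval R &
      (forall s t, A s -> A t ->
        `|mdist (phi s) (phi t) - mdist (psi s) (psi t)| <= e') /\
      (lebesgue_measure (@unit_interval R `\` A) <= (lambda * e')%:E)%E].
Proof.
move=> /inf_lt[|_ [phi [psi [pphi ppsi ->]]] /inf_lt[|e' [e'0 [A [mA AI hA lA]]] e'e]].
- have [phi pphi] := parametrisation_ex X.
  have [psi ppsi] := parametrisation_ex Y.
  by eexists; exists phi, psi.
(* The empty set of parameters is admissible for 1 / lambda. *)
- exists lambda^-1; split; first by rewrite invr_gt0.
  exists set0; split => //; rewrite setD0 divff ?gt_eqF//.
  by rewrite lebesgue_unit_interval.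
by exists phi, psi, A, e'; rewrite e'0.
Qed.

(** The product of two Polish spaces is coded, so that a coupling has a
    parametrisation, whose components parametrise X and Y. *)
Lemma gromov_box_coupling X Y
    (pi : probability (borel X * borel Y)%type R) (G : set (borel X * borel Y)) e :
  (forall A, measurable A -> pi (A `*` setT) = mm_measure X A) ->
  (forall B, measurable B -> pi (setT `*` B) = mm_measure Y B) ->
  0 < e -> measurable G ->
  (forall z z', G z -> G z' ->
     `|mdist (z.1 : X) (z'.1 : X) - mdist (z.2 : Y) (z'.2 : Y)| <= e) ->
  (pi (~` G) <= (lambda * e)%:E)%E ->
  gromov_box lambda X Y <= e.
Proof.
move=> piX piY e0 mG hG pG.
have [chi mchi chiE] := coded_parametrisation pi
  (coded_prod (coded_metric (mm_separable X)) (coded_metric (mm_separable Y))).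
have mchiG : measurable (chi @^-1` G) by rewrite -[X in measurable X]setTI; exact: mchi.
apply: (@gromov_box_le X Y (fst \o chi) (snd \o chi)
    (@unit_interval R `&` chi @^-1` G)) => //.
- apply: parametrisationP; first exact: measurableT_comp.
  move=> A mA; rewrite -piX// chiE; last exact: measurableX.
  by congr (unif R _); apply/seteqP; split => t /=; [case|].
- apply: parametrisationP; first exact: measurableT_comp.
  move=> A mA; rewrite -piY// chiE; last exact: measurableX.
  by congr (unif R _); apply/seteqP; split => t /=; [case|].
- by apply: measurableI => //; exact: measurable_unit_interval.
- by move=> s t [_ ?] [_ ?]; exact: hG.
- move: pG; rewrite chiE; last exact: measurableC.
  rewrite /unif /mrestr preimage_setC; congr (lebesgue_measure _ <= _)%E.
  by rewrite setDIr setDv set0U setIC.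
Qed.

(** Transporting the masses of the cells of X to those of Y costs at most eps
    outside E by Hall's theorem; on pairs of cells in E the two distances agree
    up to e. *)
Lemma gromov_box_cells X Y (I J : finType) (k : X -> I) (l : Y -> J)
    (E : I -> J -> bool) (eps e : R) :
  (forall i, measurable ([set x | k x = i] : set (borel X))) ->
  (forall j, measurable ([set y | l y = j] : set (borel Y))) ->
  0 < e -> 0 <= eps <= lambda * e ->
  (forall S : {set I}, (mm_measure X [set x | k x \in S] <=
     mm_measure Y [set y | l y \in neighbours E S] + eps%:E)%E) ->
  (forall x x' y y', E (k x) (l y) -> E (k x') (l y') ->
     `|mdist x x' - mdist y y'| <= e) ->
  gromov_box lambda X Y <= e.
Proof.
move=> mk ml e0 /andP[eps0 epse] hE hd.
set mu := mm_measure X in hE; set nu := mm_measure Y in hE.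
pose p i := fine (mu [set x | k x = i]); pose q j := fine (nu [set y | l y = j]).
have pE (S : {pred I}) : mu [set x | k x \in S] = (\sum_(i in S) p i)%:E.
  rewrite -[X in mu X]setTI (measure_fiber mk)// -sumEFin; apply: eq_bigr => i _.
  by rewrite setTI /p fineK// fin_num_measure.
have qE (S : {pred J}) : nu [set x | l x \in S] = (\sum_(i in S) q i)%:E.
  rewrite -[X in nu X]setTI (measure_fiber ml)// -sumEFin; apply: eq_bigr => i _.
  by rewrite setTI /q fineK// fin_num_measure.
have pq : \sum_i p i = \sum_j q j.
  have /(congr1 fine) /= := pE xpredT; rewrite (_ : [set _ | _] = setT); last first.
    by apply/seteqP; split.
  rewrite probability_setT /= => <-.
  have /(congr1 fine) /= := qE xpredT; rewrite (_ : [set _ | _] = setT); last first.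
    by apply/seteqP; split.
  by rewrite probability_setT /= => <-.
have [|||//|S|w [w0 wp wq wE]] := @hall_coupling R I J p q E eps.
- by move=> i; exact: fine_ge0.
- by move=> j; exact: fine_ge0.
- exact: eps0.
- by have := hE S; rewrite (pE (mem S)) (qE (mem (neighbours E S))) -EFinD lee_fin.
have [pi [piX piY piE]] := finite_coupling mk ml w0 wp wq.
pose G : set (borel X * borel Y) := [set z | E (k z.1) (l z.2)].
have GC : ~` G = [set z | ~~ E (k z.1) (l z.2)].
  by apply/seteqP; split => z /=; move/negP.
have mG : measurable G.
  rewrite (_ : G = [set z | (k z.1, l z.2) \in [pred ij : I * J | E ij.1 ij.2]])//.
  apply: measurable_fiber => -[i j].
  rewrite (_ : [set _ | _] = [set x | k x = i] `*` [set y | l y = j]).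
    exact: measurableX.
  by apply/seteqP; split => -[x y] /= [-> ->].
apply: (gromov_box_coupling piX piY e0 mG) => [[x y] [x' y'] /=|]; first exact: hd.
rewrite GC (piE (fun i j => ~~ E i j)) lee_fin.
exact: le_trans wE epse.
Qed.

End gromov_box_bounds.

(** * The lower bound: gluing two spaces along a parametrisation *)

Section prohorov_lemmas.
Context (R : realType) (Z : pmetricType R).
Implicit Types mu nu : set (borel Z) -> \bar R.

Lemma eneighbourhoodE (A : set Z) e :
  eneighbourhood A e = \bigcup_(a in A) [set x | mdist a x < e].
Proof.
apply/seteqP; split => x.
  by move=> /ereal_inf_lt[_ [a Aa <-]]; rewrite lte_fin; exists a.
move=> [a Aa /= ax]; apply: (@le_lt_trans _ _ (mdist a x)%:E).
  by apply: ereal_inf_lbound; exists a.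
by rewrite lte_fin.
Qed.

Lemma measurable_eneighbourhood (A : set Z) e :
  measurable (eneighbourhood A e : set (borel Z)).
Proof.
apply: borel_open; rewrite eneighbourhoodE.
by apply: bigcup_open => a _; exact: open_mdist.
Qed.

Lemma prohorov_lbound mu nu : has_lbound [set e | 0 < e /\
  forall A : set (borel Z), measurable A ->
                 (mu A <= nu (eneighbourhood A e) + e%:E)%E].
Proof. by exists 0 => e [/ltW]. Qed.

Lemma prohorov_ge0 mu nu : 0 <= prohorov mu nu.
Proof. by apply: inf_ge0 => e [/ltW]. Qed.

Lemma prohorov_le mu nu e : 0 < e ->
  (forall A : set (borel Z), measurable A ->
    (mu A <= nu (eneighbourhood A e) + e%:E)%E) -> prohorov mu nu <= e.
Proof. by move=> e0 h; apply: ge_inf => //; exact: prohorov_lbound. Qed.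

End prohorov_lemmas.

Section gromov_prohorov_lemmas.
Context (R : realType).
Implicit Types X Y : mmspace R.

Lemma gromov_prohorov_lbound X Y : has_lbound
  [set r | exists (Z : pmetricType R) (f : X -> Z) (g : Y -> Z),
        [/\ separable Z, isometric f, isometric g &
            r = prohorov (X := Z)
                  (pushforward (T1 := borel X) (T2 := borel Z) (mm_measure X) f)
                  (pushforward (T1 := borel Y) (T2 := borel Z) (mm_measure Y) g)]].
Proof. by exists 0 => _ [Z [f [g [_ _ _ ->]]]]; exact: prohorov_ge0. Qed.

Lemma gromov_prohorov_le X Y (Z : pmetricType R) (f : X -> Z) (g : Y -> Z) e :
  separable Z -> isometric f -> isometric g -> 0 < e ->
  (forall A : set (borel Z), measurable A ->
    (mm_measure X (f @^-1` A) <=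
     mm_measure Y (g @^-1` (eneighbourhood A e)) + e%:E)%E) ->
  gromov_prohorov X Y <= e.
Proof.
move=> sZ isof isog e0 h.
apply: (@le_trans _ _ (prohorov (X := Z)
  (pushforward (T1 := borel X) (T2 := borel Z) (mm_measure X) f)
  (pushforward (T1 := borel Y) (T2 := borel Z) (mm_measure Y) g))).
  by apply: ge_inf; [exact: gromov_prohorov_lbound|exists Z, f, g].
exact: prohorov_le.
Qed.

End gromov_prohorov_lemmas.

(** Corresponding points are to be placed at distance corr_gap from each other.
    The bound on their distances is the triangle inequality for paths that cross
    from one space to the other and back. *)
Record correspondence (R : realType) (X Y : pmetricType R) := Correspondence {
  corr : set (X * Y) ;
  corr_gap : R ;
  corr_gap_gt0 : 0 < corr_gap ;
  corr_neq0 : corr !=set0 ;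
  corr_dist : forall p q, corr p -> corr q ->
    `|mdist p.1 q.1 - mdist p.2 q.2| <= 2 * corr_gap
}.

Definition glue (R : realType) (X Y : pmetricType R)
  (S : correspondence X Y) : Type := (X + Y)%type.

Section glue.
Context (R : realType) (X Y : pmetricType R) (S : correspondence X Y).

Local Notation h := (corr_gap S).

Definition cross (x : X) (y : Y) : R :=
  inf [set mdist x p.1 + mdist p.2 y + h | p in corr S].

Lemma cross_le x y p : corr S p -> cross x y <= mdist x p.1 + mdist p.2 y + h.
Proof.
move=> Sp; apply: ge_inf; last by exists p.
by exists 0 => _ [q _ <-]; rewrite !addr_ge0 ?mdist_ge0// ltW// corr_gap_gt0.
Qed.

Lemma le_cross x y c :
  (forall p, corr S p -> c <= mdist x p.1 + mdist p.2 y + h) -> c <= cross x y.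
Proof.
move=> cp; apply: lb_le_inf; last by move=> _ [p Sp <-]; exact: cp.
by have [p Sp] := corr_neq0 S; exists (mdist x p.1 + mdist p.2 y + h); exists p.
Qed.

Lemma cross_ge x y : h <= cross x y.
Proof. by apply: le_cross => p Sp; rewrite lerDr addr_ge0 ?mdist_ge0. Qed.

Definition gdist (u v : glue S) : R :=
  match u, v with
  | inl x, inl x' => mdist x x'
  | inr y, inr y' => mdist y y'
  | inl x, inr y => cross x y
  | inr y, inl x => cross x y
  end.

Let gdistxx u : gdist u u = 0.
Proof. by case: u => ? /=; rewrite mdistxx. Qed.

Let gdist_sym u v : gdist u v = gdist v u.
Proof. by case: u v => [x|y] [x'|y'] //=; rewrite metric_sym. Qed.

Let gdist_positivity u v : gdist u v = 0 -> u = v.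
Proof.
have h0 := corr_gap_gt0 S.
case: u v => [x|y] [x'|y'] /=; try by move/mdist_positivity ->.
- by move=> c0; exfalso; have := cross_ge x y'; lra.
- by move=> c0; exfalso; have := cross_ge x' y; lra.
Qed.

Let cross_triangle_l x x' y : cross x y <= mdist x x' + cross x' y.
Proof.
rewrite -lerBlDl; apply: le_cross => p Sp.
have := cross_le x y Sp; have := metric_triangle x x' p.1; lra.
Qed.

Let cross_triangle_r x y y' : cross x y <= cross x y' + mdist y' y.
Proof.
rewrite -lerBlDr; apply: le_cross => p Sp.
have := cross_le x y Sp; have := metric_triangle p.2 y' y; lra.
Qed.

Let cross_dist_l x x' y : mdist x x' <= cross x y + cross x' y.
Proof.
rewrite -lerBlDr; apply: le_cross => p Sp.
rewrite lerBlDl -lerBlDr; apply: le_cross => q Sq.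
have := corr_dist Sp Sq; rewrite ler_norml => /andP[_].
have := metric_triangle x p.1 x'; have := metric_triangle p.1 q.1 x'.
have := metric_triangle p.2 y q.2.
rewrite [mdist q.1 x']metric_sym [mdist y q.2]metric_sym; lra.
Qed.

Let cross_dist_r x y y' : mdist y y' <= cross x y + cross x y'.
Proof.
rewrite -lerBlDr; apply: le_cross => p Sp.
rewrite lerBlDl -lerBlDr; apply: le_cross => q Sq.
have := corr_dist Sp Sq; rewrite ler_norml => /andP[+ _].
have := metric_triangle y p.2 y'; have := metric_triangle p.2 q.2 y'.
have := metric_triangle p.1 x q.1.
rewrite [mdist p.1 x]metric_sym [mdist y p.2]metric_sym; lra.
Qed.

Let gdist_triangle v u w : gdist u w <= gdist u v + gdist v w.
Proof.
case: u v w => [x|y] [x'|y'] [x''|y''] /=; try exact: metric_triangle.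
- exact: cross_triangle_l.
- exact: cross_dist_l.
- exact: cross_triangle_r.
- rewrite addrC [mdist x' x'']metric_sym; exact: cross_triangle_l.
- exact: cross_dist_r.
- rewrite addrC [mdist y y']metric_sym; exact: cross_triangle_r.
Qed.

HB.instance Definition _ := Choice.copy (glue S) (X + Y)%type.
HB.instance Definition _ := isPointed.Build (glue S) (inl point).
HB.instance Definition _ := @isMetric.Build R (glue S) gdist
  gdistxx gdist_positivity gdist_sym gdist_triangle.

Definition glue_space : pmetricType R := glue S.

Lemma mdist_glue (u v : glue_space) : mdist u v = gdist u v.
Proof. by []. Qed.

Lemma separable_glue : separable X -> separable Y -> separable glue_space.
Proof.
move=> /dense_seq[zx dx] /dense_seq[zy dy].
pose z n : glue_space := if odd n then inr (zy n./2) else inl (zx n./2).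
exists (range z); first exact: sub_countable (card_image_le _ _) (countableP _).
move=> O [u Ou] /metric_openP/(_ _ Ou)[r r0 rO].
case: u Ou rO => [x|y] _ rO.
  have [n nx] := dx x r r0; exists (z n.*2); split; last by exists n.*2.
  by apply: rO; rewrite /= /z odd_double doubleK mdist_glue /= metric_sym.
have [n ny] := dy y r r0; exists (z n.*2.+1); split; last by exists n.*2.+1.
by apply: rO; rewrite /= /z/= odd_double uphalf_double mdist_glue /= metric_sym.
Qed.

End glue.

Section lower_bound.
Context (R : realType).
Implicit Types X Y : mmspace R.

Lemma isometric_inl X Y (S : correspondence X Y) :
  isometric (inl : X -> glue_space S).
Proof. by []. Qed.

Lemma isometric_inr X Y (S : correspondence X Y) :
  isometric (inr : Y -> glue_space S).
Proof. by []. Qed.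

(** Any two spaces embed into a common one: glue them at a single pair of
    points. *)
Lemma gromov_prohorov_le1 X Y : gromov_prohorov X Y <= 1.
Proof.
have S2 (p q : X * Y) : [set (point, point)] p -> [set (point, point)] q ->
    `|mdist p.1 q.1 - mdist p.2 q.2| <= 2 * 1.
  by move=> -> -> /=; rewrite !mdistxx subrr normr0 mulr1.
pose S : correspondence X Y :=
  Correspondence ltr01 (ex_intro _ (point, point) erefl) S2.
apply: (gromov_prohorov_le (Z := glue_space S)
  (separable_glue _ (mm_separable X) (mm_separable Y))
  (@isometric_inl X Y S) (@isometric_inr X Y S) ltr01).
move=> A mA; apply: (@le_trans _ _ 1%E); last by rewrite leeDr.
apply: (@probability_le1 _ _ _ (mm_measure X)).
rewrite -[X in measurable X]setTI; exact: (isometric_measurable (@isometric_inl X Y S)).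
Qed.

(** Parametrisations phi and psi whose distances agree up to e on A define a
    correspondence between X and Y; gluing with gap e/2 puts phi s within e/2
    of psi s for all s in A, and the complement of A has measure at most
    lambda e. *)
Lemma gromov_prohorov_le_parametrisation (lambda : R) X Y
    (phi : measurableTypeR R -> X) (psi : measurableTypeR R -> Y)
    (A : set (measurableTypeR R)) e : 0 < lambda -> 0 < e ->
  parametrisation phi -> parametrisation psi ->
  measurable A -> A `<=` @unit_interval R ->
  (forall s t, A s -> A t ->
    `|mdist (phi s) (phi t) - mdist (psi s) (psi t)| <= e) ->
  (lebesgue_measure (@unit_interval R `\` A) <= (lambda * e)%:E)%E ->
  gromov_prohorov X Y <= Num.max (e / 2) (lambda * e).
Proof.
move=> lambda0 e0 [mphi phiE] [mpsi psiE] mA AI dA lA.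
have [A0|/set0P[s0 As0]] := eqVneq A set0.
  apply: le_trans (gromov_prohorov_le1 X Y) _; rewrite le_max; apply/orP; right.
  by move: lA; rewrite A0 setD0 lebesgue_unit_interval lee_fin.
have h0 : 0 < e / 2 by rewrite divr_gt0.
have Sn : [set (phi s, psi s) | s in A] !=set0 by exists (phi s0, psi s0); exists s0.
have Sd p q : [set (phi s, psi s) | s in A] p -> [set (phi s, psi s) | s in A] q ->
    `|mdist p.1 q.1 - mdist p.2 q.2| <= 2 * (e / 2).
  by move=> [s As <-] [t At <-] /=; rewrite mulrC divfK//; exact: dA.
pose S := Correspondence h0 Sn Sd.
apply/ler_addgt0Pr => /= d d0; set m := Num.max _ _.
have m0 : 0 < m by rewrite lt_max h0.
apply: (gromov_prohorov_le (Z := glue_space S)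
  (separable_glue _ (mm_separable X) (mm_separable Y))
  (@isometric_inl X Y S) (@isometric_inr X Y S)); first exact: addr_gt0.
move=> B mB; set B' := eneighbourhood _ _.
have mB1 : measurable ((inl : X -> glue_space S) @^-1` B : set (borel X)).
  by rewrite -[X in measurable X]setTI; exact: (isometric_measurable (@isometric_inl X Y S)).
have mB2 : measurable ((inr : Y -> glue_space S) @^-1` B' : set (borel Y)).
  rewrite -[X in measurable X]setTI.
  apply: (isometric_measurable (@isometric_inr X Y S)) => //.
  exact: measurable_eneighbourhood.
have mI := @measurable_unit_interval R.
have mB3 := mphi mI _ mB1; have mB4 := mpsi mI _ mB2.
rewrite phiE// psiE//.
apply: (@le_trans _ _ (lebesgue_measure
  ((@unit_interval R `&` psi @^-1` (inr @^-1` B')) `|` (@unit_interval R `\` A)))).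
  apply: le_measure; rewrite ?inE//.
    by apply: measurableU => //; exact: measurableD.
  move=> s [Is /= Bs]; have [As|nAs] := pselect (A s); last by right.
  left; split => //=; rewrite /B' eneighbourhoodE; exists (inl (phi s)) => //=.
  rewrite mdist_glue /= (@le_lt_trans _ _ (e / 2))//; last first.
    by rewrite (@le_lt_trans _ _ m) ?ltrDl// le_max lexx.
  have Sp : corr S (phi s, psi s) by exists s.
  by apply: le_trans (cross_le _ _ Sp) _; rewrite /= !mdistxx !add0r.
apply: le_trans (measureU2 _ _ _) _ => //; first exact: measurableD.
rewrite leeD2l// (le_trans lA)// lee_fin (@le_trans _ _ m) ?lerDl ?(ltW d0)//.
by rewrite le_max lexx orbT.
Qed.

Lemma gromov_box_lower_bound (lambda : R) X Y : 0 < lambda ->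
  Num.min 2 lambda^-1 * gromov_prohorov X Y <= gromov_box lambda X Y.
Proof.
move=> lambda0; apply/ler_addgt0Pr => /= d d0.
have [|phi [psi [A [e [pphi ppsi /andP[e0 ed] [mA AI] [dA lA]]]]]] :=
  @gromov_box_ltP R lambda lambda0 X Y (gromov_box lambda X Y + d).
  by rewrite ltrDl.
apply: le_trans (ltW ed).
have := gromov_prohorov_le_parametrisation lambda0 e0 pphi ppsi mA AI dA lA.
have l0 : 0 < lambda^-1 by rewrite invr_gt0.
move=> /(ler_wpM2l (ltW (_ : 0 < Num.min 2 lambda^-1))) => /(_ ltac:(by rewrite lt_min l0 ltr0n)).
move=> /le_trans; apply; rewrite maxr_pMr ?le_min ?ler0n ?(ltW l0)//.
rewrite ge_max; apply/andP; split.
  apply: (@le_trans _ _ (2 * (e / 2))); last by rewrite mulrC divfK.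
  by rewrite ler_wpM2r ?divr_ge0 ?(ltW e0)// ge_min lexx.
apply: (@le_trans _ _ (lambda^-1 * (lambda * e))); last by rewrite mulKf ?gt_eqF.
by rewrite ler_wpM2r ?mulr_ge0 ?(ltW e0) ?(ltW lambda0)// ge_min lexx orbT.
Qed.

End lower_bound.

(** * The upper bound: a finite form of Strassen's theorem *)

Section cells.
Context d (T : measurableType d) (R : realType) (N : nat) (U : 'I_N -> set T).
Hypothesis mU : forall i, measurable (U i).

(** The cells are disjoint subsets of the U i, with a rest outside all of
    them. *)
Definition cell (x : T) : option 'I_N := [pick i | `[< U i x >]].

Lemma cell_some x i : cell x = Some i -> U i x.
Proof. by rewrite /cell; case: pickP => // j /asboolP Uj [<-]. Qed.

Lemma cell_none x : cell x = None -> forall i, ~ U i x.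
Proof.
by rewrite /cell; case: pickP => // nU _ i /asboolP Ui; have := nU i; rewrite /= Ui.
Qed.

Lemma measurable_cell o : measurable [set x | cell x = o].
Proof.
pose pat x : {ffun 'I_N -> bool} := [ffun i => `[< U i x >]].
have mpat s : measurable [set x | pat x = s].
  rewrite (_ : [set _ | _] = \bigcap_i (if s i then U i else ~` U i)).
    apply: fin_bigcap_measurable => [|i _]; first exact: finite_finset.
    by case: (s i) => //; exact: measurableC.
  apply/seteqP; split => [x /= <- i /= _|x /= hx].
    by rewrite ffunE; case: asboolP.
  by apply/ffunP => i; rewrite ffunE; have := hx i Logic.I; case: (s i); case: asboolP.
rewrite (_ : [set _ | _] =
    [set x | pat x \in [pred s : {ffun 'I_N -> bool} | [pick i | s i] == o]]).
  exact: measurable_fiber.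
have patE x : [pick i | pat x i] = cell x by apply: eq_pick => i; rewrite ffunE.
by apply/seteqP; split => x /=; rewrite inE patE => /eqP.
Qed.

End cells.

Section covering.
Context (R : realType) d (T : measurableType d) (mu : probability T R).

Lemma finite_cover (U : nat -> set T) (eta : R) : 0 < eta ->
  (forall n, measurable (U n)) -> mu (\bigcup_n U n) = 1%E ->
  \forall N \near \oo, (mu (~` \bigcup_(n in `I_N) U n) <= eta%:E)%E.
Proof.
move=> eta0 mU U1; pose V N := \bigcup_(n in `I_N) U n.
have mV N : measurable (V N) by exact: bigcup_measurable.
have VU : \bigcup_N V N = \bigcup_n U n.
  apply/seteqP; split => [x [N _ [n _ Un]]|x [n _ Un]]; first by exists n.
  by exists n.+1 => //; exists n => /=.
have : mu \o V @ \oo --> mu (\bigcup_N V N).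
  apply: nondecreasing_cvg_mu => //; first exact: bigcupT_measurable.
  move=> m n mn; apply/subsetPset => x [i /= im Ui]; exists i => //=.
  exact: leq_trans mn.
rewrite VU U1 => V1.
have : \forall N \near \oo, ((1 - eta)%:E < mu (V N))%E.
  have eta1 : ((1 - eta)%:E < 1%:E)%E by rewrite lte_fin; lra.
  by have /V1 : nbhs 1%E [set y | (1 - eta)%:E < y]%E by exact: lt_nbhsr eta1.
apply: filterS => N /ltW h; rewrite probability_setC; last exact: mV.
rewrite -(fineK (fin_num_measure mu _ (mV N))) in h *.
by rewrite -EFinB lee_fin; move: h; rewrite lee_fin; lra.
Qed.

End covering.

Section upper_bound.
Context (R : realType) (lambda : R) (lambda0 : 0 < lambda).
Implicit Types X Y : mmspace R.

(** A dense sequence z of Z cuts X and Y into finitely many cells of radius eta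
    and a rest of mass eta.  A set of cells of X is mapped into a union B of
    balls of Z, and the e-neighbourhood of B meets only those cells of Y whose
    centres are within e + 2 eta of those of B.  So the Prohorov inequality is
    Hall's condition, up to the mass of the rests. *)
Lemma gromov_box_le_prohorov X Y (Z : pmetricType R) (f : X -> Z) (g : Y -> Z)
    (e e' : R) : separable Z -> isometric f -> isometric g -> 0 < e < e' ->
  (forall A : set (borel Z), measurable A ->
    (mm_measure X (f @^-1` A) <=
     mm_measure Y (g @^-1` (eneighbourhood A e)) + e%:E)%E) ->
  gromov_box lambda X Y <= Num.max 2 lambda^-1 * e'.
Proof.
move=> /dense_seq[z dz] isof isog /andP[e0 ee'] hP.
set mu := mm_measure X in hP; set nu := mm_measure Y in hP.
pose eta := (e' - e) / 4; have eta0 : 0 < eta by rewrite divr_gt0// subr_gt0.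
have e'E : e' = e + 4 * eta by rewrite /eta; lra.
have mf := isometric_measurable isof; have mg := isometric_measurable isog.
pose U n : set (borel X) := f @^-1` [set y | mdist (z n) y < eta].
pose V n : set (borel Y) := g @^-1` [set y | mdist (z n) y < eta].
have mU n : measurable (U n).
  by rewrite -[X in measurable X]setTI; apply: mf => //; exact: borel_ball.
have mV n : measurable (V n).
  by rewrite -[X in measurable X]setTI; apply: mg => //; exact: borel_ball.
have U1 : mu (\bigcup_n U n) = 1%E.
  rewrite -(probability_setT mu); congr (mu _); rewrite -subTset => x _.
  by have [n nx] := dz (f x) eta eta0; exists n.
have V1 : nu (\bigcup_n V n) = 1%E.
  rewrite -(probability_setT nu); congr (nu _); rewrite -subTset => x _.
  by have [n nx] := dz (g x) eta eta0; exists n.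
have [N [hU hV]] : exists N, (mu (~` \bigcup_(n in `I_N) U n) <= eta%:E)%E /\
    (nu (~` \bigcup_(n in `I_N) V n) <= eta%:E)%E.
  near \oo => N; exists N; split; near: N; exact: finite_cover.
pose U' (i : 'I_N) := U i; pose V' (i : 'I_N) := V i.
have mU' i : measurable (U' i) by exact: mU.
have mV' i : measurable (V' i) by exact: mV.
have mk := measurable_cell mU'; have ml := measurable_cell mV'.
pose E (i j : option 'I_N) := if i is Some i' then if j is Some j' then
  mdist (z i') (z j') < e + 2 * eta else false else false.
set c := Num.max _ _.
have c2 : 2 <= c by rewrite le_max lexx.
have cl : lambda^-1 <= c by rewrite le_max lexx orbT.
have cl1 : 1 <= lambda * c.
  by rewrite -(@divff _ lambda) ?gt_eqF// ler_wpM2l// ltW.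
have e'0 : 0 < e' by exact: lt_trans ee'.
have c0 : 0 < c by apply: lt_le_trans c2; rewrite ltr0n.
apply: (@gromov_box_cells R lambda X Y (option 'I_N) (option 'I_N)
  (cell U') (cell V') E (e + 2 * eta) (c * e')) => //.
- exact: mulr_gt0.
- apply/andP; split; first lra.
  apply: (@le_trans _ _ (1 * e')); first by rewrite mul1r e'E; lra.
  by rewrite mulrA ler_wpM2r// ltW.
- move=> S; pose B : set (borel Z) :=
    \bigcup_(n in [set n | exists2 i : 'I_N, Some i \in S & n = i :> nat])
      [set y | mdist (z n) y < eta].
  have mB : measurable B by apply: bigcup_measurable => n _; exact: borel_ball.
  have mfB : measurable (f @^-1` B : set (borel X)).
    by rewrite -[X in measurable X]setTI; exact: mf.
  have mgB : measurable (g @^-1` (eneighbourhood B e) : set (borel Y)).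
    by rewrite -[X in measurable X]setTI; apply: mg => //; exact: measurable_eneighbourhood.
  have mCU : measurable (~` \bigcup_(n in `I_N) U n).
    by apply: measurableC; exact: bigcup_measurable.
  have mCV : measurable (~` \bigcup_(n in `I_N) V n).
    by apply: measurableC; exact: bigcup_measurable.
  apply: (@le_trans _ _ (mu ((f @^-1` B) `|` ~` \bigcup_(n in `I_N) U n))).
    apply: le_measure; rewrite ?inE; [exact: (measurable_fiber mk)|exact: measurableU|].
    move=> x /= kS; case kx: (cell U' x) kS => [i|] iS; last first.
      right => -[n /= nN Un]; exact: (cell_none kx (Un : U' (Ordinal nN) x)).
    by left; exists i; [exists i|exact: (cell_some kx)].
  apply: (le_trans (measureU2 _ mfB mCU)).
  apply: (@le_trans _ _ (nu (g @^-1` eneighbourhood B e) + e%:E + eta%:E)%E).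
    by apply: leeD => //; exact: hP.
  have -> : (e + 2 * eta)%:E = (eta%:E + (e%:E + eta%:E))%E.
    by rewrite -!EFinD; congr (_%:E); lra.
  rewrite -addeA [leRHS]addeA; apply: leeD => //.
  apply: (@le_trans _ _ (nu ([set y | cell V' y \in neighbours E S] `|`
                            ~` \bigcup_(n in `I_N) V n))).
    apply: le_measure; rewrite ?inE//.
      by apply: measurableU => //; exact: (measurable_fiber ml).
    move=> y /=; rewrite eneighbourhoodE => -[b [n [i iS ->] /= zib] bgy].
    case ly: (cell V' y) => [j|]; last first.
      right => -[m /= mN Vm]; exact: (cell_none ly (Vm : V' (Ordinal mN) y)).
    left; rewrite inE; apply/existsP; exists (Some i); rewrite iS /E.
    have zjy : mdist (z j) (g y) < eta := cell_some ly; move: zib bgy zjy.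
    have := metric_triangle (z i) b (z j); have := metric_triangle b (g y) (z j).
    rewrite [mdist (g y) (z j)]metric_sym; lra.
  apply: le_trans (measureU2 _ _ mCV) _; first exact: (measurable_fiber ml).
  by rewrite leeD2l.
- move=> x x' y y'; rewrite /E.
  have near_ (x0 : X) (y0 : Y) : E (cell U' x0) (cell V' y0) ->
      mdist (f x0) (g y0) < e'.
    rewrite /E; case kx: (cell U' x0) => [i|//]; case ly: (cell V' y0) => [j|//].
    have : mdist (z i) (f x0) < eta := cell_some kx.
    have : mdist (z j) (g y0) < eta := cell_some ly; rewrite e'E.
    have := metric_triangle (f x0) (z i) (g y0).
    have := metric_triangle (z i) (z j) (g y0).
    rewrite [mdist (f x0) (z i)]metric_sym; lra.
  move=> /near_ h1 /near_ h2; rewrite -(isof x) -(isog y).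
  have : 2 * e' <= c * e' by rewrite ler_wpM2r// ltW.
  have := metric_triangle (f x) (g y) (f x').
  have := metric_triangle (g y) (g y') (f x').
  have := metric_triangle (g y) (f x) (g y').
  have := metric_triangle (f x) (f x') (g y').
  rewrite [mdist (g y') (f x')]metric_sym [mdist (g y) (f x)]metric_sym ler_norml.
  by move=> *; apply/andP; split; lra.
Unshelve. all: by end_near. Qed.

Lemma gromov_box_upper_bound X Y :
  gromov_box lambda X Y <= Num.max 2 lambda^-1 * gromov_prohorov X Y.
Proof.
set c := Num.max _ _.
have c0 : 0 < c by rewrite lt_max ltr0n.
suff h e : gromov_prohorov X Y < e -> gromov_box lambda X Y <= c * e.
  rewrite -ler_pdivrMl//; apply/ler_addgt0Pr => d d0.
  by rewrite ler_pdivrMl//; apply: h; rewrite ltrDl.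
move=> /inf_lt[|_ [Z [f [g [sZ isof isog ->]]]] /inf_lt[|e1 [e10 hP] e1e]].
- have p2 (p q : X * Y) : [set (point, point)] p -> [set (point, point)] q ->
      `|mdist p.1 q.1 - mdist p.2 q.2| <= 2 * 1.
    by move=> -> -> /=; rewrite !mdistxx subrr normr0 mulr1.
  pose S : correspondence X Y :=
    Correspondence ltr01 (ex_intro _ (point, point) erefl) p2.
  eexists; exists (glue_space S), inl, inr; split => //.
  exact: (separable_glue _ (mm_separable X) (mm_separable Y)).
- exists 1; split; first exact: ltr01.
  move=> A mA; rewrite /pushforward.
  apply: (@le_trans _ _ 1%E); last by rewrite leeDr// measure_ge0.
  apply: (@probability_le1 _ _ _ (mm_measure X)).
  by rewrite -[X in measurable X]setTI; exact: (isometric_measurable isof).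
by apply: (gromov_box_le_prohorov sZ isof isog _ hP); rewrite e10.
Qed.

End upper_bound.

(** * Invariance under isomorphism *)

Section support.
Context (R : realType) (X : mmspace R).

Local Notation mu := (mm_measure X).

Lemma open_suppC : open (~` supp mu).
Proof.
apply/metric_openP => x /= nx.
have [U [oU [Ux U0]]] : exists U : set X, open U /\ U x /\ ~ (0 < mu U)%E.
  by apply: contrapT => h; apply: nx => U oU Ux; apply: contrapT => U0; apply: h; exists U.
have /metric_openP/(_ _ Ux)[r r0 rU] := oU; exists r => // y /= xy ys.
by apply: U0; apply: ys => //; exact: rU.
Qed.

Lemma measurable_supp : measurable (supp mu : set (borel X)).
Proof.
by rewrite -[X in measurable X]setCK; apply: measurableC; apply: borel_open; exact: open_suppC.
Qed.

(** The complement of the support is covered by countably many null balls. *)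
Lemma measure_suppC : mu (~` supp mu) = 0%E.
Proof.
have [z dz] := dense_seq (mm_separable X).
pose Bl n k : set (borel X) := [set y | mdist (z n) y < k.+1%:R^-1].
have mB n k : measurable (Bl n k) by exact: borel_ball.
apply: measure_negligible; first exact: measurableC measurable_supp.
apply: (@negligibleS _ _ _ _
  (\bigcup_n \bigcup_k if mu (Bl n k) == 0%E then Bl n k else set0)); last first.
  apply: negligible_bigcup => n; apply: negligible_bigcup => k.
  case: eqP => [B0|_]; last exact: negligible_set0.
  exact/negligibleP.
suff H (x : X) : ~ supp mu x ->
    (\bigcup_n \bigcup_k if mu (Bl n k) == 0%E then Bl n k else set0) x.
  by move=> x; exact: H.
move=> nx; have [U [oU [Ux U0]]] : exists U : set X, open U /\ U x /\ ~ (0 < mu U)%E.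
  by apply: contrapT => h; apply: nx => U oU Ux; apply: contrapT => U0; apply: h; exists U.
have /metric_openP/(_ _ Ux)[r r0 rU] := oU.
have [k kr] : exists k, k.+1%:R^-1 < r / 2 by apply: exists_invS_lt; rewrite divr_gt0.
have k0 : 0 < k.+1%:R^-1 :> R by rewrite invr_gt0.
have [n nx'] := dz x _ k0.
have BU : Bl n k `<=` U.
  move=> y zy; apply: rU; rewrite /= (le_lt_trans (metric_triangle x (z n) _))//.
  by rewrite [r]splitr ltrD ?(lt_trans _ kr)// metric_sym.
exists n => //; exists k => //; rewrite ifT//.
rewrite eq_le measure_ge0 andbT; apply: (@le_trans _ _ (mu U)).
  by apply: le_measure; rewrite ?inE//; exact: borel_open.
by rewrite leNgt; exact/negP.
Qed.

End support.

Section isomorphism.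
Context (R : realType) (lambda : R) (lambda0 : 0 < lambda).
Implicit Types X Y : mmspace R.

Lemma gromov_box_sym X Y : gromov_box lambda X Y = gromov_box lambda Y X.
Proof.
suff h X' Y' : gromov_box lambda X' Y' <= gromov_box lambda Y' X'.
  by apply/le_anti; rewrite !h.
apply/ler_addgt0Pr => d d0.
have [|phi [psi [A [e [pphi ppsi /andP[e0 ed] [mA AI] [dA lA]]]]]] :=
  @gromov_box_ltP R lambda lambda0 Y' X' (gromov_box lambda Y' X' + d).
  by rewrite ltrDl.
apply: le_trans (ltW ed); apply: (gromov_box_le ppsi pphi e0 mA AI _ lA).
by move=> s t As At; rewrite distrC; exact: dA.
Qed.

Lemma mm_iso_parametrisation X Y (f : X -> Y) (phi : measurableTypeR R -> X) :
  measure_preserving (T := borel X) (T' := borel Y) setT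
    (mm_measure X) (mm_measure Y) f ->
  parametrisation phi -> parametrisation (f \o phi).
Proof.
move=> [mf fE] [mphi phiE]; split; first exact: (measurableT_comp mf mphi).
move=> A mA; rewrite fE// setTI phiE//.
by rewrite -[X in measurable X]setTI; exact: mf.
Qed.

(** Isomorphisms preserve distances on the support only, so sets of parameters
    are restricted to the preimage of the support, which has full measure. *)
Lemma parametrisation_supp X (phi : measurableTypeR R -> X)
    (A : set (measurableTypeR R)) : parametrisation phi ->
  measurable A -> A `<=` @unit_interval R ->
  exists A' : set (measurableTypeR R), [/\ measurable A', A' `<=` A,
    forall s, A' s -> supp (mm_measure X) (phi s) &
    lebesgue_measure (@unit_interval R `\` A') =
    lebesgue_measure (@unit_interval R `\` A)].
Proof.
move=> [mphi phiE] mA AI.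
have mI := @measurable_unit_interval R.
have mS := mphi mI _ (@measurable_supp R X).
have mSC := mphi mI _ (measurableC (@measurable_supp R X)).
have mA' : measurable (A `&` (@unit_interval R `&` phi @^-1` supp (mm_measure X))).
  exact: measurableI.
exists (A `&` (@unit_interval R `&` phi @^-1` supp (mm_measure X))); split => //.
- by move=> s [_ []].
have mD : measurable (@unit_interval R `\` A) by exact: measurableD.
apply/le_anti/andP; split.
  apply: (@le_trans _ _ (lebesgue_measure ((@unit_interval R `\` A) `|`
      (@unit_interval R `&` phi @^-1` (~` supp (mm_measure X)))))).
    apply: le_measure; rewrite ?inE; [exact: measurableD|exact: measurableU|].
    move=> s [Is nAs]; have [As|nA] := pselect (A s); last by left.
    by right; split => //= sp; apply: nAs.
  apply: le_trans (measureU2 _ mD mSC) _.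
  rewrite -[leRHS]adde0; apply: leeD => //.
  rewrite le_eqVlt; apply/orP; left; apply/eqP.
  transitivity (mm_measure X (~` supp (mm_measure X))).
    by apply/esym/phiE; apply: measurableC; exact: measurable_supp.
  exact: measure_suppC.
by apply: le_measure; rewrite ?inE//; [exact: measurableD|move=> s [Is nA]; split => // -[]].
Qed.

Lemma gromov_box_isol X X' Y : mm_iso X X' ->
  gromov_box lambda X' Y <= gromov_box lambda X Y.
Proof.
move=> [f [fmp fiso]]; apply/ler_addgt0Pr => d d0.
have [|phi [psi [A [e [pphi ppsi /andP[e0 ed] [mA AI] [dA lA]]]]]] :=
  @gromov_box_ltP R lambda lambda0 X Y (gromov_box lambda X Y + d).
  by rewrite ltrDl.
have [A' [mA' A'A A'S lA']] := parametrisation_supp pphi mA AI.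
apply: le_trans (ltW ed).
apply: (gromov_box_le (mm_iso_parametrisation fmp pphi) ppsi e0 mA').
- exact: subset_trans AI.
- by move=> s t A's A't /=; rewrite -fiso; [apply: dA; exact: A'A|exact: A'S..].
- by rewrite lA'.
Qed.

Lemma gromov_box_iso0 X X' : mm_iso X X' -> gromov_box lambda X X' <= 0.
Proof.
move=> [f [fmp fiso]]; apply/ler_addgt0Pr => e e0; rewrite add0r.
have [phi pphi] := parametrisation_ex X.
have mI := @measurable_unit_interval R.
have [A' [mA' A'A A'S lA']] := parametrisation_supp pphi mI (@subset_refl _ _).
apply: (gromov_box_le pphi (mm_iso_parametrisation fmp pphi) e0 mA' A'A).
- move=> s t A's A't /=; rewrite -fiso; [|exact: A'S..].
  by rewrite subrr normr0 ltW.
- by rewrite lA' setDv measure0 lee_fin mulr_ge0// ltW.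
Qed.

Lemma mm_iso_refl X : mm_iso X X.
Proof.
by exists idfun; split => //; split; [exact: measurable_id|move=> A mA; rewrite setTI].
Qed.

(** By reflexivity, each of two spaces with equal classes belongs to the class
    of the other. *)
Lemma mm_class_iso X X' : mm_class X = mm_class X' -> mm_iso X X' /\ mm_iso X' X.
Proof.
move=> /(congr1 sval) /= h; split.
  by have : [set Y | mm_iso X' Y] X' := mm_iso_refl X'; rewrite -h.
by have : [set Y | mm_iso X Y] X := mm_iso_refl X; rewrite h.
Qed.

Lemma mm_class_surj (C : mmclass R) : exists X, C = mm_class X.
Proof.
case: C => C [X CX]; exists X; rewrite /mm_class; move: (ex_intro _ X erefl) => p.
by subst C; congr exist; exact: Prop_irrelevance.
Qed.

Lemma gromov_box_class X X' Y Y' :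
  mm_class X = mm_class X' -> mm_class Y = mm_class Y' ->
  gromov_box lambda X Y = gromov_box lambda X' Y'.
Proof.
move=> /mm_class_iso[XX' X'X] /mm_class_iso[YY' Y'Y].
transitivity (gromov_box lambda X' Y).
  by apply/le_anti; rewrite !gromov_box_isol.
rewrite [LHS]gromov_box_sym [RHS]gromov_box_sym.
by apply/le_anti; rewrite !gromov_box_isol.
Qed.

End isomorphism.

(** * Polynomials are continuous for Gromov's metric *)

Section product_powers.
Context (R : realType).

Definition tcons_of d (T : measurableType d) n (x : T) (xs : n.-tuple T) :
  n.+1.-tuple T := [tuple of x :: xs].

Lemma measurable_tcons_of d (T : measurableType d) n (x : T) (A : set (n.+1.-tuple T)) :
  measurable A -> measurable [set xs : n.-tuple T | A (tcons_of x xs)].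
Proof.
move=> mA; rewrite -[X in measurable X]setTI.
by apply: (measurable_cons (f := cst x) (g := id)).
Qed.

Lemma product_measure_powerS d (T : measurableType d) (P : probability T R) n
    (A : set (n.+1.-tuple T)) : measurable A ->
  product_measure_power P n.+1 A =
  (\int[P]_x product_measure_power P n [set xs | A (tcons_of x xs)])%E.
Proof.
move=> mA; rewrite /= /distribution /pushforward /product_measure1/=.
apply: eq_integral => x _ /=; congr (product_measure_power P n _).
by apply/seteqP; split => xs; rewrite /xsection/= in_setE.
Qed.

Lemma measurable_product_measure_power_section d (T : measurableType d)
    (P : probability T R) n (A : set (n.+1.-tuple T)) : measurable A ->
  measurable_fun setT
    (fun x => product_measure_power P n [set xs | A (tcons_of x xs)]).
Proof.
move=> mA.
have mA' : measurable (@tcons _ T n @^-1` A).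
  by rewrite -[X in measurable X]setTI; exact: measurable_tcons.
apply: eq_measurable_fun (measurable_fun_xsection (product_measure_power P n) mA').
move=> x _ /=; congr (product_measure_power P n _).
by apply/seteqP; split => xs; rewrite /xsection/= in_setE.
Qed.

Lemma measurable_map_tuple d d' (T : measurableType d) (T' : measurableType d')
    (f : T -> T') n : measurable_fun setT f ->
  measurable_fun setT (fun ss : n.-tuple T => [tuple of map f ss]).
Proof.
move=> mf; apply/measurable_fun_tnthP => i.
rewrite (_ : _ \o _ = fun ss => f (tnth ss i)); last first.
  by apply/funext => ss /=; rewrite tnth_map.
by apply: (measurableT_comp mf); exact: measurable_tnth.
Qed.

Lemma product_measure_power_image d d' (T : measurableType d)
    (T' : measurableType d') (P : probability T R) (Q : probability T' R)
    (f : T -> T') : measurable_fun setT f ->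
  (forall A, measurable A -> Q A = P (f @^-1` A)) ->
  forall n (A : set (n.-tuple T')), measurable A ->
  product_measure_power Q n A =
  product_measure_power P n ((fun ss : n.-tuple T => [tuple of map f ss]) @^-1` A).
Proof.
move=> mf QP; elim=> [|n ih] A mA.
  rewrite /= !diracE; congr (nat_of_bool _)%:R%:E; rewrite /preimage.
  by apply/idP/idP; rewrite !inE /= (tuple0 [tuple of map f [tuple]]).
have mfA : measurable ((fun ss : n.+1.-tuple T => [tuple of map f ss]) @^-1` A).
  by rewrite -[X in measurable X]setTI; exact: measurable_map_tuple.
rewrite !product_measure_powerS//.
rewrite (eq_measure_integral (pushforward P f)); last by move=> B mB _; exact: QP.
rewrite ge0_integral_pushforward//; last first.
  by apply: measurable_product_measure_power_section.
rewrite preimage_setT; apply: eq_integral => s _ /=.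
rewrite ih; last exact: measurable_tcons_of.
congr (product_measure_power P n _); apply/seteqP; split => ss /=;
  by congr A; apply/val_inj.
Qed.

(** A union bound over the coordinates. *)
Lemma product_measure_power_exists d (T : measurableType d) (P : probability T R)
    (A : set T) n : measurable A ->
  (product_measure_power P n [set ss | exists i, A (tnth ss i)] <=
   n%:R%:E * P A)%E.
Proof.
move=> mA.
have mex k : measurable [set ss : k.-tuple T | exists i, A (tnth ss i)].
  rewrite (_ : [set _ | _] = \bigcup_i ((fun ss : k.-tuple T => tnth ss i) @^-1` A)).
    apply: fin_bigcup_measurable => [|i _]; first exact: finite_finset.
    by rewrite -[X in measurable X]setTI; exact: measurable_tnth.
  by apply/seteqP; split => ss [i]; [exists i|move=> _ ?; exists i].
elim: n => [|n ih].
  rewrite mul0e (_ : [set _ | _] = set0) ?measure0//.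
  by apply/seteqP; split => // ss [[]].
rewrite /= /distribution /pushforward.
apply: (@le_trans _ _ ((P \x product_measure_power P n)%E ((A `*` setT) `|`
    (setT `*` [set ss | exists i, A (tnth ss i)])))).
  apply: le_measure; rewrite ?inE.
  - by rewrite -[X in measurable X]setTI; apply: measurable_tcons => //; exact: mex.
  - by apply: measurableU; apply: measurableX => //; exact: mex.
  - move=> [s ss] /= [i]; case: (unliftP ord0 i) => [j ->|->].
      by rewrite tnthS => Aj; right; split => //; exists j.
    by rewrite tnth0; left.
apply: le_trans (measureU2 _ _ _) _; [exact: measurableX|by apply: measurableX => //; exact: mex|].
have h1 := product_measure1E P (product_measure_power P n) mA measurableT.
have h2 := product_measure1E P (product_measure_power P n) measurableT (mex n).
apply: (@le_trans _ _ (P A * product_measure_power P n setT + P setT *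
    product_measure_power P n [set ss | exists i, A (tnth ss i)])%E).
  by apply: leeD; rewrite le_eqVlt; apply/orP; left; apply/eqP; [exact: h1|exact: h2].
rewrite !probability_setT mule1 mul1e -natr1 EFinD ge0_muleDl// mul1e addeC.
by rewrite leeD2r.
Qed.

End product_powers.

Section measurable_matrices.
Context (R : realType) d (T : measurableType d).

Lemma open_rat_matrix m n (O : set 'M[R]_(m, n)) (B : 'M[R]_(m, n)) :
  open O -> O B -> exists (q : 'M[rat]_(m, n)) k,
    (forall i j, `|B i j - ratr (q i j)| < k.+1%:R^-1) /\
    [set C : 'M[R]_(m, n) | forall i j, `|C i j - ratr (q i j)| < k.+1%:R^-1] `<=` O.
Proof.
rewrite openE => /[apply] /nbhs_ballP[r /= r0 rO].
have [k kr] : exists k, k.+1%:R^-1 < r / 2 by apply: exists_invS_lt; rewrite divr_gt0.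
have k0 : 0 < k.+1%:R^-1 :> R by rewrite invr_gt0.
have ex (i : 'I_m) (j : 'I_n) : {q : rat | `|B i j - ratr q| < k.+1%:R^-1}.
  apply: cid; have [|q] := @rat_in_itvoo R (B i j - k.+1%:R^-1) (B i j + k.+1%:R^-1).
    by rewrite ltrD2l gtrN.
  by rewrite in_itv/= => qB; exists q; rewrite ltr_distlC.
pose q : 'M[rat]_(m, n) := \matrix_(i, j) sval (ex i j).
exists q, k; split => [i j|C /= hC]; first by rewrite mxE; exact: (svalP (ex i j)).
apply: rO; split => // i j; rewrite -ball_normE/=.
rewrite (le_lt_trans (ler_distD (ratr (q i j)) _ _))// [r]splitr.
by rewrite ltrD// (lt_trans _ kr)//; [rewrite mxE; exact: (svalP (ex i j))|rewrite distrC].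
Qed.

(** The entries of a matrix determine its Borel sigma-algebra: open sets of
    matrices are countable unions of boxes with rational centres. *)
Lemma measurable_matrix m n (h : T -> 'M[R]_(m, n)) (O : set 'M[R]_(m, n)) :
  (forall i j, measurable_fun setT (fun t => h t i j)) -> open O ->
  measurable (h @^-1` O).
Proof.
move=> mh oO.
pose box_ (q : 'M[rat]_(m, n)) k := [set C : 'M[R]_(m, n) |
  forall i j, `|C i j - ratr (q i j)| < k.+1%:R^-1].
pose F a := if unpickle a is Some q then
   \bigcup_(k in [set k | box_ q k `<=` O]) (h @^-1` box_ q k) else set0.
rewrite (_ : _ @^-1` _ = \bigcup_a F a); last first.
  apply/seteqP; split => [t /= Ot|t [a _]].
    have [q [k [hk kO]]] := open_rat_matrix oO Ot.
    by exists (pickle q) => //; rewrite /F pickleK; exists k.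
  by rewrite /F; case: unpickle => [q [k /= kO /kO]|].
apply: bigcupT_measurable => a; rewrite /F; case: unpickle => [q|//].
apply: bigcup_measurable => k _.
rewrite (_ : _ @^-1` _ = \bigcap_i \bigcap_j
    [set t | `|h t i j - ratr (q i j)| < k.+1%:R^-1]); last first.
  by apply/seteqP; split => t /= ht => [i _ j _|i j]; apply: ht.
apply: fin_bigcap_measurable => [|i _]; first exact: finite_finset.
apply: fin_bigcap_measurable => [|j _]; first exact: finite_finset.
rewrite (_ : [set _ | _] = (fun t => `|h t i j - ratr (q i j)|) @^-1`
    `]-oo, k.+1%:R^-1[%classic).
  rewrite -[X in measurable X]setTI; apply: measurableT_comp => //.
  exact: measurable_funB.
by apply/seteqP; split => t /=; rewrite in_itv.
Qed.

Lemma measurable_continuous_matrix m n (h : T -> 'M[R]_(m, n)) (phi : 'M[R]_(m, n) -> R) :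
  continuous phi -> (forall i j, measurable_fun setT (fun t => h t i j)) ->
  measurable_fun setT (phi \o h).
Proof.
move=> cphi mh; apply: measurable_ltr => r; rewrite setTI.
apply: (measurable_matrix (O := [set C | phi C < r])) => //.
have -> : [set C | phi C < r] = phi @^-1` [set x | x < r] by [].
by apply: open_comp => [C _|]; [exact: cphi|exact: open_lt].
Qed.

End measurable_matrices.

Section polynomial_continuity.
Context (R : realType).
Implicit Types X Y : mmspace R.

Definition dist_matrix (T : Type) (d : T -> T -> R) n (x : n.-tuple T) : 'M[R]_n :=
  \matrix_(i, j) d (tnth x i) (tnth x j).

Definition polynomial_value n (phi : 'M[R]_n -> R) X : R :=
  \int[product_measure_power (mm_measure X) n]_x
    phi (dist_matrix (fun x y : X => mdist x y) x).

Lemma measurable_dist_matrix d (T : measurableType d) X (f : T -> borel X) n :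
  measurable_fun setT f -> forall i j, measurable_fun setT
    (fun t : n.-tuple T => dist_matrix (fun s t => mdist (f s : X) (f t : X)) t i j).
Proof.
move=> mf i j; have [z dz] := dense_seq (mm_separable X).
apply: (@eq_measurable_fun _ _ _ _ _
    (fun t : n.-tuple T => mdist (f (tnth t i) : X) (f (tnth t j) : X))).
  by move=> t _; rewrite mxE.
by apply: (measurable_mdist2 dz); apply: (measurableT_comp mf); exact: measurable_tnth.
Qed.

Lemma measurable_dist_matrix_id X n i j : measurable_fun setT
  (fun x : n.-tuple (borel X) => dist_matrix (fun x y : X => mdist x y) x i j).
Proof.
by have := @measurable_dist_matrix _ (borel X) X id n (@measurable_id _ _ _) i j.
Qed.

Lemma measurable_dist_matrix_open X n (O : set 'M[R]_n) : open O ->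
  measurable [set x : n.-tuple (borel X) |
    O (dist_matrix (fun x y : X => mdist x y) x)].
Proof.
move=> oO.
pose h (x : n.-tuple (borel X)) := dist_matrix (fun x y : X => mdist x y) x.
suff : measurable (h @^-1` O) by [].
by apply: measurable_matrix oO => i j; exact: measurable_dist_matrix_id.
Qed.

Lemma integrable_bounded d (T : measurableType d) (P : probability T R)
    (f : T -> R) (M : R) : measurable_fun setT f -> (forall x, `|f x| <= M) ->
  P.-integrable setT (EFin \o f).
Proof.
move=> mf fM; apply: measurable_bounded_integrable => //.
  by apply: (le_lt_trans (probability_le1 P measurableT)); rewrite ltry.
exists M; split; first exact: num_real.
by move=> y My x _ /=; rewrite (le_trans (fM x))// ltW.
Qed.

(** Makes polynomials of X and of Y comparable, as integrals over the same
    space of n independent uniform parameters. *)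
Lemma polynomial_value_image d (T : measurableType d) (P : probability T R) X
    (f : T -> borel X) n (phi : 'M[R]_n -> R) (M : R) : continuous phi ->
  (forall D, `|phi D| <= M) -> measurable_fun setT f ->
  (forall A, measurable A -> mm_measure X A = P (f @^-1` A)) ->
  polynomial_value phi X = \int[product_measure_power P n]_t
    phi (dist_matrix (fun s t => mdist (f s : X) (f t : X)) t).
Proof.
move=> cphi phiM mf fE; rewrite /polynomial_value /Rintegral; congr fine.
pose F (t : n.-tuple T) : n.-tuple (borel X) := [tuple of map f t].
have mF : measurable_fun setT F by exact: measurable_map_tuple.
pose h (x : n.-tuple (borel X)) := phi (dist_matrix (fun x y : X => mdist x y) x).
have mh : measurable_fun setT h.
  apply: (measurable_continuous_matrix cphi) => i j.
  exact: measurable_dist_matrix_id.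
transitivity (\int[pushforward (product_measure_power P n) F]_x (h x)%:E)%E.
  apply: eq_measure_integral => A mA _.
  exact: (product_measure_power_image mf fE).
rewrite integral_pushforward//; last 2 first.
- exact/measurable_EFinP.
- rewrite preimage_setT; apply: (@integrable_bounded _ _ _ _ (M)) => //.
    exact: measurableT_comp.
  by move=> t; exact: phiM.
rewrite preimage_setT; apply: eq_integral => t _ /=; congr (phi _)%:E.
by apply/matrixP => i j; rewrite !mxE !tnth_map.
Qed.

(** Outside [0, 1] a parametrisation may fail to be measurable; there it is
    replaced by a constant. *)
Lemma parametrisation_total X (phi : measurableTypeR R -> X) :
  parametrisation phi -> exists f : measurableTypeR R -> borel X,
  [/\ measurable_fun setT f, forall s, unit_interval s -> f s = phi s &
      forall A, measurable A -> mm_measure X A = unif R (f @^-1` A)].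
Proof.
move=> [mphi phiE]; have mI := @measurable_unit_interval R.
exists (fun s => if s \in @unit_interval R then phi s else point); split.
- apply: measurable_fun_if => //.
  + by apply: (measurable_fun_bool true); rewrite setTI preimage_mem_true.
  + by rewrite setTI preimage_mem_true.
- by move=> s Is; rewrite mem_set.
- move=> A mA; rewrite phiE// /unif /mrestr setIC; congr lebesgue_measure.
  by apply/seteqP; split => s /= [+ Is]; rewrite mem_set.
Qed.

(** The interiors of the balls make this set open, so that its preimage under
    measurable maps is measurable. *)
Definition oscillation n (phi : 'M[R]_n -> R) (eps r : R) : set 'M[R]_n :=
  \bigcup_B ((ball B r)° `&` [set A | eps < `|phi A - phi B|]).

Lemma open_oscillation n (phi : 'M[R]_n -> R) (eps r : R) : continuous phi ->
  open (oscillation phi eps r).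
Proof.
move=> cphi; apply: bigcup_open => B _; apply: openI; first exact: open_interior.
have -> : [set A | eps < `|phi A - phi B|] =
    phi @^-1` ([set y | phi B + eps < y] `|` [set y | y < phi B - eps]).
  apply/seteqP; split => A /=; rewrite ltr_normr.
    by move=> /orP[?|?]; [left|right]; lra.
  by move=> [?|?]; apply/orP; [left|right]; lra.
apply: open_comp; first by move=> A _; exact: cphi.
by apply: openU; [exact: open_gt|exact: open_lt].
Qed.

Lemma oscillationS n (phi : 'M[R]_n -> R) (eps r s : R) : r <= s ->
  oscillation phi eps r `<=` oscillation phi eps s.
Proof.
move=> rs A [B _ [AB ?]]; exists B => //; split => //.
by apply: interiorS AB; exact: le_ball.
Qed.

Lemma oscillation_bigcap n (phi : 'M[R]_n -> R) (eps : R) : continuous phi -> 0 < eps ->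
  \bigcap_k oscillation phi eps k.+1%:R^-1 = set0.
Proof.
move=> cphi eps0; apply/seteqP; split => // A hA.
have /cvgrPdist_le/(_ _ eps0)/nbhs_ballP[r /= r0 rA] := cphi A.
have [k kr] := exists_invS_lt r0.
have [B _ [AB]] := hA k I.
rewrite /= ltNge => /negP; apply; apply: rA.
have /ball_sym BA : ball B k.+1%:R^-1 A by exact: interior_subset AB.
by apply: le_ball BA; exact: ltW.
Qed.

(** By continuity of phi the oscillation sets decrease to the empty set. *)
Lemma oscillation_small X n (phi : 'M[R]_n -> R) (eps eps' : R) : continuous phi ->
  0 < eps -> 0 < eps' -> exists2 r, 0 < r &
  (product_measure_power (mm_measure X) n [set x |
    oscillation phi eps r (dist_matrix (fun x y : X => mdist x y) x)] <= eps'%:E)%E.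
Proof.
move=> cphi eps0 eps'0.
pose F k : set (n.-tuple (borel X)) := [set x |
  oscillation phi eps k.+1%:R^-1 (dist_matrix (fun x y : X => mdist x y) x)].
have mF k : measurable (F k).
  by apply: measurable_dist_matrix_open; exact: open_oscillation.
set P := product_measure_power _ _.
have : P \o F @ \oo --> P (\bigcap_k F k).
  apply: nonincreasing_cvg_mu => //.
  - by apply: (le_lt_trans (probability_le1 P (mF _))); rewrite ltry.
  - exact: bigcapT_measurable.
  - move=> i j ij; apply/subsetPset => x; apply: oscillationS.
    by rewrite lef_pV2 ?posrE// ler_nat.
rewrite (_ : \bigcap_k F k = set0) ?measure0; last first.
  apply/seteqP; split => // x Fx.
  have : (\bigcap_k oscillation phi eps k.+1%:R^-1)
      (dist_matrix (fun x y : X => mdist x y) x) by move=> k _; exact: (Fx k).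
  by rewrite oscillation_bigcap.
move=> P0; have lt0 : (0 < eps'%:E)%E by rewrite lte_fin.
have /P0[N _ /(_ N (leqnn N))] : nbhs 0%E [set y | y < eps'%:E]%E by exact: lt_nbhsl lt0.
by move=> /= /ltW h; exists N.+1%:R^-1 => //; rewrite invr_gt0.
Qed.

(** Parametrise X and Y so that the distances are within e of each other on a
    set A of almost full measure.  For n independent uniform points, all in A
    with high probability, the two distance matrices are then close, and the
    distance matrix of X avoids the oscillation set with high probability,
    which does not depend on the parametrisation. *)
Lemma polynomial_value_continuous X n (phi : 'M[R]_n -> R) (M : R) (eps : R) :
  continuous phi -> (forall D, `|phi D| <= M) -> 0 < eps ->
  exists2 e, 0 < e & forall Y, gromov_box 1 X Y < e ->
    `|polynomial_value phi X - polynomial_value phi Y| <= eps.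
Proof.
move=> cphi phiM eps0.
have M0 : 0 <= M by apply: le_trans (phiM 0).
have den0 : 0 < 1 + 2 * M * (n%:R + 1) by rewrite ltr_wpDr// !mulr_ge0// addr_ge0.
have [eps1 eps10 eps1E] : exists2 eps1 : R, 0 < eps1 &
    (1 + 2 * M * (n%:R + 1)) * eps1 = eps.
  exists (eps / (1 + 2 * M * (n%:R + 1))); first by rewrite divr_gt0.
  by rewrite mulrC divfK// gt_eqF.
have [r r0 hr] := oscillation_small X cphi eps10 eps10.
exists (Num.min eps1 (r / 2)); first by rewrite lt_min eps10 divr_gt0.
move=> Y /(gromov_box_ltP ltr01)[phi1 [phi2 [A [e [p1 p2 /andP[e0 +] [mA AI] [dA lA]]]]]].
rewrite lt_min => /andP[ee er].
have [f [mf fphi fE]] := parametrisation_total p1.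
have [g [mg gphi gE]] := parametrisation_total p2.
rewrite (polynomial_value_image cphi phiM mf fE).
rewrite (polynomial_value_image cphi phiM mg gE).
set P := product_measure_power (unif R) n.
pose DX := dist_matrix (n := n) (fun s t => mdist (f s : X) (f t : X)).
pose DY := dist_matrix (n := n) (fun s t => mdist (g s : Y) (g t : Y)).
have mDX i j : measurable_fun setT (fun t => DX t i j).
  exact: measurable_dist_matrix.
have mDY i j : measurable_fun setT (fun t => DY t i j).
  exact: measurable_dist_matrix.
have mX : measurable_fun setT (phi \o DX) by exact: measurable_continuous_matrix.
have mY : measurable_fun setT (phi \o DY) by exact: measurable_continuous_matrix.
have iX : P.-integrable setT (EFin \o (phi \o DX)).
  by apply: (@integrable_bounded _ _ _ _ M) => // t; exact: phiM.
have iY : P.-integrable setT (EFin \o (phi \o DY)).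
  by apply: (@integrable_bounded _ _ _ _ M) => // t; exact: phiM.
pose bad1 : set (n.-tuple (measurableTypeR R)) := [set t | exists i, (~` A) (tnth t i)].
pose bad2 : set (n.-tuple (measurableTypeR R)) := DX @^-1` oscillation phi eps1 r.
have mbad2 : measurable bad2 by apply: measurable_matrix => //; exact: open_oscillation.
have mbad1 : measurable bad1.
  rewrite (_ : bad1 = \bigcup_i ((fun t => tnth t i) @^-1` ~` A)).
    apply: fin_bigcup_measurable => [|i _]; first exact: finite_finset.
    rewrite -[X in measurable X]setTI; apply: measurable_tnth => //.
    exact: measurableC.
  by apply/seteqP; split => t [i]; [exists i|move=> _ ?; exists i].
have Pbad1 : (P bad1 <= (n%:R * eps1)%:E)%E.
  apply: (le_trans (product_measure_power_exists (unif R) n (measurableC mA))).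
  have uA : (lebesgue_measure (~` A `&` @unit_interval R) <= eps1%:E)%E.
    by rewrite setIC -setDE (le_trans lA)// mul1r lee_fin ltW.
  by rewrite EFinM lee_wpmul2l//; exact: uA.
have Pbad2 : (P bad2 <= eps1%:E)%E.
  apply: le_trans hr; rewrite (product_measure_power_image mf fE).
    rewrite le_eqVlt; apply/orP; left; apply/eqP; congr (P _).
    apply/seteqP; split => t; rewrite /bad2 /DX /=; set D1 := dist_matrix _ _;
    set D2 := dist_matrix _ _;
    by rewrite (_ : D1 = D2)//; apply/matrixP => i j; rewrite !mxE !tnth_map.
  by apply: measurable_dist_matrix_open; exact: open_oscillation.
pose bad := bad1 `|` bad2; have mbad : measurable bad by exact: measurableU.
have Pbad : (P bad <= ((n%:R + 1) * eps1)%:E)%E.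
  apply: le_trans (measureU2 _ mbad1 mbad2) _.
  by rewrite mulrDl mul1r EFinD leeD.
have good t : ~ bad t -> `|phi (DX t) - phi (DY t)| <= eps1.
  move=> nbad; rewrite leNgt; apply/negP => h; apply: nbad.
  have [/existsNP[i nAi]|/contrapT At] := pselect (~ forall i, A (tnth t i)).
    by left; exists i.
  right; exists (DY t) => //; split => //.
  have YX : ball (DY t) (r / 2) (DX t).
    split; first by rewrite divr_gt0.
    move=> i j; rewrite -ball_normE/= !mxE distrC !fphi ?gphi; try exact: AI.
    by apply: le_lt_trans er; exact: dA.
  apply/nbhs_ballP; exists (r / 2); first by rewrite /= divr_gt0.
  by move=> C XC; rewrite [r]splitr; exact: ball_triangle XC.
have iI : P.-integrable setT (EFin \o (fun t => eps1 + 2 * M * \1_bad t)).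
  apply: (@integrable_bounded _ _ _ _ (eps1 + 2 * M)).
    by apply: measurable_funD => //; apply: measurable_funM => //; exact: measurable_indic.
  move=> t; rewrite ger0_norm ?addr_ge0 ?mulr_ge0 ?(ltW eps10)//.
  by rewrite lerD2l ler_piMr ?mulr_ge0// indicE lern1 leq_b1.
rewrite -RintegralB//; apply: le_trans (le_normr_Rintegral _ _) _ => //.
  apply: (@integrable_bounded _ _ _ _ (M + M)); first exact: measurable_funB.
  by move=> t; rewrite (le_trans (ler_normB _ _))// lerD ?phiM.
apply: (@le_trans _ _ (\int[P]_t (eps1 + 2 * M * \1_bad t))).
  apply: le_Rintegral => //.
    apply: (@integrable_bounded _ _ _ _ (2 * M)).
      by apply: measurableT_comp => //; exact: measurable_funB.
    move=> t; rewrite normr_id (le_trans (ler_normB _ _))// mulr_natl mulr2n.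
    by rewrite lerD ?phiM.
  move=> t _; have [bt|nbt] := pselect (bad t).
    rewrite indicE mem_set// mulr1 ler_wpDl ?(ltW eps10)//.
    by rewrite (le_trans (ler_normB _ _))// mulr_natl mulr2n lerD ?phiM.
  by rewrite indicE memNset// mulr0 addr0; exact: good.
rewrite RintegralD//; last 2 first.
- by apply: (@integrable_bounded _ _ _ _ (eps1)) => // t; rewrite ger0_norm// ltW.
- apply: (@integrable_bounded _ _ _ _ (2 * M)).
    by apply: measurable_funM => //; exact: measurable_indic.
  move=> t; rewrite ger0_norm ?mulr_ge0//.
  by rewrite ler_piMr ?mulr_ge0// indicE lern1 leq_b1.
rewrite RintegralZl//; last first.
  apply: (@integrable_bounded _ _ _ _ (1)); first exact: measurable_indic.
  by move=> t; rewrite ger0_norm// indicE lern1 leq_b1.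
rewrite Rintegral_cst// (congr1 fine (probability_setT P)) mulr1.
have -> : \int[P]_t \1_bad t = fine (P bad).
  by rewrite /Rintegral integral_indic// setIT.
have Pb : fine (P bad) <= (n%:R + 1) * eps1.
  by rewrite -lee_fin fineK// fin_num_measure.
apply: (@le_trans _ _ (eps1 + 2 * M * ((n%:R + 1) * eps1))).
  by rewrite lerD2l ler_wpM2l// mulr_ge0.
by rewrite mulrA -[X in X + _]mul1r -mulrDl eps1E.
Qed.

End polynomial_continuity.

(** * Iterated integrals *)

Section iterated_integrals.
Context (R : realType) d (T : measurableType d) (nu : probability T R).
Local Open Scope ereal_scope.

(** Unlike integrals against the product power, these can be bounded and
    split without any measurability, since the integral of a nonnegative
    function is a supremum over the simple functions below it. *)
Fixpoint iter_int n (K : seq T -> \bar R) : \bar R :=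
  if n is n'.+1 then \int[nu]_x iter_int n' (fun s => K (x :: s)) else K [::].

Lemma le_integral_ge0 (f g : T -> \bar R) : (forall x, 0 <= f x) ->
  (forall x, f x <= g x) -> \int[nu]_x f x <= \int[nu]_x g x.
Proof.
move=> f0 fg; rewrite !ge0_integralTE//; last by move=> x; exact: le_trans (fg x).
by apply: ereal_sup_le => _ [h hf <-]; exists h => // x; exact: le_trans (fg x).
Qed.

Lemma iter_int_ge0 n K : (forall s, 0 <= K s) -> 0 <= iter_int n K.
Proof.
elim: n K => [|n ih] K K0 //=.
by apply: integral_ge0 => x _; apply: ih => s; exact: K0.
Qed.

Lemma eq_iter_int n K K' : (forall s, size s = n -> K s = K' s) ->
  iter_int n K = iter_int n K'.
Proof.
elim: n K K' => [|n ih] K K' KK' /=; first exact: KK'.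
by apply: eq_integral => x _; apply: ih => s sn; apply: KK'; rewrite /= sn.
Qed.

Lemma iter_intD m n K :
  iter_int (m + n) K = iter_int m (fun s => iter_int n (fun s' => K (s ++ s'))).
Proof.
by elim: m K => [|m ih] K //=; apply: eq_integral => x _; rewrite ih.
Qed.

Lemma iter_int_le n K (C : R) : (forall s, 0 <= K s) -> (0 <= C)%R ->
  (forall s, size s = n -> K s <= C%:E) -> iter_int n K <= C%:E.
Proof.
elim: n K => [|n ih] K K0 C0 KC /=; first exact: KC.
apply: (@le_trans _ _ (\int[nu]_x C%:E)).
  apply: le_integral_ge0 => x; first exact: iter_int_ge0.
  by apply: ih => // s sn; apply: KC; rewrite /= sn.
apply: (@le_trans _ _ (C%:E * nu setT)); first by rewrite integral_cst.
by rewrite probability_setT mule1.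
Qed.

(** Each integral is restricted to the corresponding set B i. *)
Lemma iter_int_ge n K (C : R) (B : nat -> set T) : (forall s, 0 <= K s) ->
  (0 <= C)%R -> (forall i, measurable (B i)) ->
  (forall t0 s, size s = n -> (forall i, (i < n)%N -> B i (nth t0 s i)) ->
     C%:E <= K s) ->
  (C * \prod_(i < n) fine (nu (B i)))%:E <= iter_int n K.
Proof.
elim: n K B => [|n ih] K B K0 C0 mB KC.
  rewrite big_ord0 mulr1; apply: (KC point) => // i; by rewrite ltn0.
rewrite big_ord_recl mulrCA /=.
set c := (C * _)%R.
have c0 : (0 <= c)%R.
  by rewrite mulr_ge0// prodr_ge0// => i _; exact: fine_ge0.
apply: (@le_trans _ _ (\int[nu]_x (c * \1_(B 0%N) x)%:E)); last first.
  apply: le_integral_ge0 => x; first by rewrite lee_fin mulr_ge0.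
  have [Bx|nBx] := pselect (B 0%N x); last first.
    by rewrite indicE memNset// mulr0; apply: iter_int_ge0.
  rewrite indicE mem_set// mulr1.
  apply: (ih (fun s => K (x :: s)) (fun i => B i.+1)) => // t0 s sn Bs.
  apply: (KC t0) => [/=|[|i] /=]; [by rewrite sn|by []|exact: Bs].
rewrite (_ : (fun x => _) = fun x => c%:E * (\1_(B 0%N) x)%:E); last first.
  by apply/funext => x; rewrite EFinM.
rewrite ge0_integralZl//; last by apply/measurable_EFinP; exact: measurable_indic.
by rewrite integral_indic// setIT mulrC EFinM fineK// fin_num_measure.
Qed.

Lemma product_measure_power_int n (K : seq T -> R) : (forall s, 0 <= K s)%R ->
  measurable_fun setT (fun x : n.-tuple T => K x) ->
  \int[product_measure_power nu n]_x (K x)%:E = iter_int n (EFin \o K).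
Proof.
elim: n K => [|n ih] K K0 mK /=.
  by rewrite integral_dirac ?diracT ?mul1e//; exact/measurable_EFinP.
pose P := product_measure_power nu n.
pose f (x : T * n.-tuple T) := (K (tcons x))%:E.
have mf : measurable_fun setT f.
  apply/measurable_EFinP.
  exact: (measurableT_comp mK (@measurable_tcons _ T n)).
transitivity (\int[(nu \x P)]_x f x).
  rewrite ge0_integral_pushforward//.
    exact/measurable_EFinP.
  by move=> x _; rewrite lee_fin.
rewrite (fubini_tonelli1 _ mf) => [|x]; last by rewrite lee_fin.
apply: eq_integral => x _; rewrite /fubini_F -ih//.
apply: (measurableT_comp mK (f := fun x : n.+1.-tuple T => K x) (g := tcons_of x)).
move=> _ A mA; rewrite setTI; exact: measurable_tcons_of.
Qed.

End iterated_integrals.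

(** * Continuous cutoffs *)

Section real_continuity.
Context (R : realType) (T : topologicalType).
Implicit Types f g : T -> R.

Lemma continuous_add f g : continuous f -> continuous g ->
  continuous (fun x => f x + g x).
Proof. by move=> cf cg x; exact: (cvgD (cf x) (cg x)). Qed.

Lemma continuous_sub f g : continuous f -> continuous g ->
  continuous (fun x => f x - g x).
Proof. by move=> cf cg x; exact: (cvgB (cf x) (cg x)). Qed.

Lemma continuous_mul f g : continuous f -> continuous g ->
  continuous (fun x => f x * g x).
Proof. by move=> cf cg x; exact: (cvgM (cf x) (cg x)). Qed.

Lemma continuous_maxr f g : continuous f -> continuous g ->
  continuous (fun x => Num.max (f x) (g x)).
Proof. by move=> cf cg x; exact: (continuous_max (cf x) (cg x)). Qed.

Lemma continuous_minr f g : continuous f -> continuous g ->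
  continuous (fun x => Num.min (f x) (g x)).
Proof. by move=> cf cg x; exact: (continuous_min (cf x) (cg x)). Qed.

Lemma continuous_normr f : continuous f -> continuous (fun x => `|f x|).
Proof. by move=> cf x; exact: (cvg_norm (cf x)). Qed.

Lemma continuous_const (c : R) : continuous (fun _ : T => c).
Proof. by move=> x; exact: cvg_cst. Qed.

Lemma continuous_bigop (op : R -> R -> R) (c : R) (I : Type) (r : seq I)
    (P : pred I) (f : I -> T -> R) :
  (forall f g, continuous f -> continuous g -> continuous (fun x => op (f x) (g x))) ->
  (forall i, P i -> continuous (f i)) ->
  continuous (fun x => \big[op/c]_(i <- r | P i) f i x).
Proof.
move=> cop cf; elim: r => [|i r ih].
  under eq_fun do rewrite big_nil; exact: continuous_const.
have [Pi|nPi] := boolP (P i); last by under eq_fun do rewrite big_cons (negPf nPi).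
by under eq_fun do rewrite big_cons Pi; exact: cop (cf i Pi) ih.
Qed.

End real_continuity.

Section soft_cover.
Context (R : realType) (eta : R) (eta0 : 0 < eta).

Definition cutoff (t : R) : R := Num.max 0 (Num.min 1 (2 - t / eta)).

Lemma cutoff_ge0 t : 0 <= cutoff t.
Proof. by rewrite le_max lexx. Qed.

Lemma cutoff_le1 t : cutoff t <= 1.
Proof. by rewrite ge_max ler01 ge_min lexx. Qed.

Lemma cutoff_near t : t < eta -> cutoff t = 1.
Proof.
move=> te; apply/le_anti; rewrite cutoff_le1 /cutoff le_max le_min lexx/=.
have : t / eta <= 1 by rewrite ler_pdivrMr// mul1r ltW.
by move=> h; apply/orP; right; lra.
Qed.

Lemma cutoff_far t : 2 * eta <= t -> cutoff t = 0.
Proof.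
move=> te; apply/le_anti; rewrite cutoff_ge0 andbT /cutoff ge_max lexx/= ge_min.
have : 2 <= t / eta by rewrite ler_pdivlMr.
by move=> h; apply/orP; right; lra.
Qed.

Lemma cutoff_lipschitz s t rho : `|s - t| <= rho -> cutoff s <= cutoff t + rho / eta.
Proof.
move=> st.
have : t / eta - s / eta <= rho / eta.
  rewrite -mulrBl ler_pM2r ?invr_gt0// (le_trans (ler_norm _))// distrC.
  exact: st.
have : 0 <= rho / eta by rewrite divr_ge0 ?(ltW eta0)// (le_trans _ st).
rewrite /cutoff; move: (s / eta) (t / eta) (rho / eta) => a b c c0 h.
have h1 : 0 <= Num.max 0 (Num.min 1 (2 - b)) by rewrite le_max lexx.
have h2 : Num.min 1 (2 - b) <= Num.max 0 (Num.min 1 (2 - b)) by rewrite le_max lexx orbT.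
rewrite ge_max; apply/andP; split; first lra.
rewrite (@le_trans _ _ (Num.min 1 (2 - b) + c)) ?lerD2r//.
by case: (leP 1 (2 - b)) => ?; rewrite ge_min; apply/orP; [left|right]; lra.
Qed.

Lemma continuous_cutoff (T : topologicalType) (f : T -> R) :
  continuous f -> continuous (fun x => cutoff (f x)).
Proof.
move=> cf; apply: continuous_maxr; first exact: continuous_const.
apply: continuous_minr; first exact: continuous_const.
apply: continuous_sub; first exact: continuous_const.
by apply: continuous_mul => //; exact: continuous_const.
Qed.

(** With t i the distances of a point to given centres, this is a continuous
    function between the indicators of the eta- and the 2 eta-neighbourhood of
    the centres with index in S. *)
Definition soft N (S : {set 'I_N}) (t : 'I_N -> R) : R :=
  \big[Num.max/0]_(i in S) cutoff (t i).

Lemma soft_ge0 N (S : {set 'I_N}) t : 0 <= soft S t.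
Proof. exact: bigmax_ge_id. Qed.

Lemma soft_le1 N (S : {set 'I_N}) t : soft S t <= 1.
Proof. by apply: bigmax_le => // i _; exact: cutoff_le1. Qed.

Lemma soft_near N (S : {set 'I_N}) t i : i \in S -> t i < eta -> soft S t = 1.
Proof.
move=> iS ti; apply/le_anti; rewrite soft_le1/= -(cutoff_near ti).
exact: (le_bigmax_cond _ (fun i => cutoff (t i))).
Qed.

Lemma soft_far N (S : {set 'I_N}) t : (forall i, i \in S -> 2 * eta <= t i) ->
  soft S t = 0.
Proof.
move=> h; apply/le_anti; rewrite soft_ge0 andbT.
by apply: bigmax_le => // i iS; rewrite cutoff_far// h.
Qed.

Lemma soft_lipschitz N (S : {set 'I_N}) s t rho : 0 <= rho ->
  (forall i, `|s i - t i| <= rho) -> soft S s <= soft S t + rho / eta.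
Proof.
move=> rho0 st; apply: bigmax_le.
  by rewrite addr_ge0 ?soft_ge0// divr_ge0// ltW.
move=> i iS; apply: (le_trans (cutoff_lipschitz (st i))); rewrite lerD2r.
exact: (le_bigmax_cond _ (fun i => cutoff (t i))).
Qed.

Lemma continuous_soft (T : topologicalType) N (S : {set 'I_N}) (f : 'I_N -> T -> R) :
  (forall i, continuous (f i)) -> continuous (fun x => soft S (fun i => f i x)).
Proof.
move=> cf; apply: continuous_bigop => [f' g'|i _]; first exact: continuous_maxr.
exact: continuous_cutoff.
Qed.

Lemma measurable_soft d (T : measurableType d) N (S : {set 'I_N}) (f : 'I_N -> T -> R) :
  (forall i, measurable_fun setT (f i)) ->
  measurable_fun setT (fun x => soft S (fun i => f i x)).
Proof.
move=> mf.
pose h x : 'rV[R]_N := \row_i f i x.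
pose phi (A : 'rV[R]_N) := soft S (fun i => A ord0 i).
apply: (@eq_measurable_fun _ _ _ _ _ (phi \o h)).
  by move=> x _ /=; congr (soft S _); apply/funext => i; rewrite mxE.
apply: measurable_continuous_matrix => [|i j].
  by apply: continuous_soft => i; exact: coord_continuous.
by apply: (@eq_measurable_fun _ _ _ _ _ (f j)) => // x _; rewrite mxE.
Qed.

End soft_cover.

(** * Moments as iterated integrals *)

Section moments.
Context (R : realType) d (T : measurableType d) (nu : probability T R).
Context (I : finType) (f : I -> T -> R) (M : R).
Hypotheses (mf : forall i, measurable_fun setT (f i))
           (fM : forall i x, `|f i x| <= M).

Let e i : R := \int[nu]_x f i x.

Lemma integral_affine (a : R) (b : I -> R) :
  (\int[nu]_x (a + \sum_i b i * f i x)%:E = (a + \sum_i b i * e i)%:E)%E.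
Proof.
have iI i : nu.-integrable setT (EFin \o (fun x => b i * f i x)).
  apply: (@integrable_bounded _ _ _ _ _ (`|b i| * M)); first exact: measurable_funM.
  by move=> x; rewrite normrM ler_wpM2l.
under eq_integral do rewrite EFinD -sumEFin.
rewrite integralD//=; last 2 first.
- apply: (@integrable_bounded _ _ _ _ _ (`|a|)) => //.
- by apply: integrable_sum => // i _; exact: iI.
rewrite EFinD; congr (_ + _)%E.
  transitivity (a%:E * nu setT)%E; first by rewrite integral_cst.
  by rewrite probability_setT mule1.
rewrite integral_sum// -sumEFin; apply: eq_bigr => i _.
have iF : nu.-integrable setT (EFin \o f i).
  by apply: (@integrable_bounded _ _ _ _ _ M).
under eq_integral do rewrite EFinM.
rewrite integralZl// EFinM; congr (_ * _)%E.
by rewrite /e /Rintegral fineK//; exact: integrable_fin_num.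
Qed.

(** A square of an integral is a double integral of a product, so the powers
    of an affine combination of such squares are iterated integrals as well. *)
Lemma iter_int_moments (t0 : T) m (a alpha gamma : R) :
  iter_int nu m.*2 (fun s => (a * \prod_(k < m) (alpha - gamma *
    \sum_i f i (nth t0 s k.*2) * f i (nth t0 s k.*2.+1)))%:E) =
  (a * (alpha - gamma * \sum_i e i ^+ 2) ^+ m)%:E.
Proof.
elim: m a => [|m ih] a; first by rewrite /= big_ord0 expr0.
rewrite doubleS /=; set q := alpha - _.
have affine b (u v : I -> R) : b * (alpha - gamma * \sum_i u i * v i) * q ^+ m =
    b * q ^+ m * alpha + \sum_i (- (b * q ^+ m * gamma) * u i) * v i.
  under [in RHS]eq_bigr => i _ do rewrite -mulrA.
  rewrite -mulr_sumr; set w := \sum_i _; lra.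
transitivity (\int[nu]_x (a * q ^+ m * alpha +
    \sum_i (- (a * q ^+ m * gamma) * e i) * f i x)%:E)%E.
  apply: eq_integral => x _.
  transitivity (\int[nu]_y (a * q ^+ m * alpha +
      \sum_i (- (a * q ^+ m * gamma) * f i x) * f i y)%:E)%E.
    apply: eq_integral => y _.
    under [LHS]eq_iter_int => s _ do rewrite big_ord_recl mulrA /=.
    by rewrite ih affine.
  rewrite integral_affine; congr (_ + _)%:E; apply: eq_bigr => i _; lra.
by rewrite integral_affine exprS mulrA affine.
Qed.

End moments.

(** * Neighbourhoods in the Gromov-weak topology *)

Section matching.
Context (R : realType) (eta : R) (eta0 : 0 < eta).
Implicit Types X Y : mmspace R.

(** This lies between the masses of the eta- and the 2 eta-neighbourhood of the
    centres c i with i in S, and is Lipschitz in the centres. *)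
Definition soft_mass X N (c : 'I_N -> X) (S : {set 'I_N}) : R :=
  \int[mm_measure X]_z soft eta S (fun i => mdist (c i) z).

Lemma measurable_soft_mdist X N (c : 'I_N -> X) (S : {set 'I_N}) :
  measurable_fun setT (fun z : borel X => soft eta S (fun i => mdist (c i) z)).
Proof. by apply: measurable_soft => i; exact: measurable_mdist. Qed.

Lemma integrable_soft_mdist X N (c : 'I_N -> X) (S : {set 'I_N}) :
  (mm_measure X).-integrable setT
    (EFin \o (fun z : borel X => soft eta S (fun i => mdist (c i) z))).
Proof.
apply: (@integrable_bounded _ _ _ _ _ 1); first exact: measurable_soft_mdist.
by move=> z; rewrite ger0_norm ?soft_le1 ?soft_ge0.
Qed.

Lemma soft_mass_ge X N (c : 'I_N -> X) (S : {set 'I_N}) (B : set (borel X)) :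
  measurable B ->
  (forall z, B z -> exists2 i, i \in S & mdist (c i) z < eta) ->
  (mm_measure X B <= (soft_mass c S)%:E)%E.
Proof.
move=> mB hB; rewrite /soft_mass /Rintegral fineK; last first.
  exact: (integrable_fin_num measurableT (integrable_soft_mdist c S)).
rewrite -[B]setIT -integral_indic//; apply: le_integral_ge0 => z.
  by rewrite lee_fin.
rewrite lee_fin indicE; have [Bz|nBz] := pselect (B z).
  by have [i iS iz] := hB z Bz; rewrite mem_set// (soft_near eta0 iS iz).
by rewrite memNset// soft_ge0.
Qed.

Lemma soft_mass_le X N (c : 'I_N -> X) (S : {set 'I_N}) (B : set (borel X)) :
  measurable B ->
  (forall z i, i \in S -> mdist (c i) z < 2 * eta -> B z) ->
  ((soft_mass c S)%:E <= mm_measure X B)%E.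
Proof.
move=> mB hB; rewrite /soft_mass /Rintegral fineK; last first.
  exact: (integrable_fin_num measurableT (integrable_soft_mdist c S)).
rewrite -[B]setIT -integral_indic//; apply: le_integral_ge0 => z.
  by rewrite lee_fin soft_ge0.
rewrite lee_fin indicE; have [Bz|nBz] := pselect (B z).
  by rewrite mem_set// soft_le1.
rewrite memNset// soft_far// => i iS; rewrite leNgt; apply/negP => iz.
by apply: nBz; exact: hB iz.
Qed.

Lemma soft_mass_lipschitz X N (c c' : 'I_N -> X) (S : {set 'I_N}) rho :
  0 <= rho -> (forall i, mdist (c i) (c' i) <= rho) ->
  `|soft_mass c S - soft_mass c' S| <= rho / eta.
Proof.
move=> rho0.
suff h (u v : 'I_N -> X) : (forall i, mdist (u i) (v i) <= rho) ->
    soft_mass u S <= soft_mass v S + rho / eta.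
  move=> cc'; have := h _ _ cc'.
  have /h : forall i, mdist (c' i) (c i) <= rho by move=> i; rewrite metric_sym.
  by rewrite ler_norml => *; apply/andP; split; lra.
move=> uv; rewrite /soft_mass.
have -> : rho / eta = \int[mm_measure X]_z (rho / eta).
  by rewrite Rintegral_cst// (congr1 fine (probability_setT (mm_measure X))) mulr1.
have ic : (mm_measure X).-integrable setT (EFin \o (fun _ : borel X => rho / eta)).
  by apply: (@integrable_bounded _ _ _ _ _ `|rho / eta|).
have iu := integrable_soft_mdist u S; have iv := integrable_soft_mdist v S.
rewrite -RintegralD//; apply: le_Rintegral => //.
  by have := integrableD measurableT iv ic.
move=> z _; apply: soft_lipschitz => // i; rewrite (le_trans _ (uv i))// ler_norml.
have := metric_triangle (u i) (v i) z; have := metric_triangle (v i) (u i) z.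
by rewrite [mdist (v i) (u i)]metric_sym => *; apply/andP; split; lra.
Qed.

(** The balls of radius eta around the x i, and those of radius 2 eta around
    the y i, are cut into cells; the masses of the unions of these balls give
    Hall's condition for the relation between cells whose centres in Y are at
    distance less than 4 eta. *)
Lemma gromov_box_le_matching X Y N (x : 'I_N -> X) (y : 'I_N -> Y) :
  (mm_measure X (~` \bigcup_i [set z | (mdist (x i) z < eta)%R]) <= eta%:E)%E ->
  (forall i j, `|mdist (y i) (y j) - mdist (x i) (x j)| <= eta) ->
  (forall S, soft_mass x S <= soft_mass y S + eta) ->
  gromov_box 1 X Y <= 15 * eta.
Proof.
move=> hx xy hS; set mu := mm_measure X in hx; set nu := mm_measure Y.
pose U (i : 'I_N) : set (borel X) := [set z | mdist (x i) z < eta].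
pose V (i : 'I_N) : set (borel Y) := [set z | mdist (y i) z < 2 * eta].
have mU i : measurable (U i) by exact: borel_ball.
have mV i : measurable (V i) by exact: borel_ball.
have mk := measurable_cell mU; have ml := measurable_cell mV.
pose E (i j : option 'I_N) := if i is Some i' then if j is Some j' then
  mdist (y i') (y j') < 4 * eta else false else false.
apply: (@gromov_box_cells R 1 X Y (option 'I_N) (option 'I_N)
  (cell U) (cell V) E (2 * eta) (15 * eta)) => //.
- by rewrite mulr_gt0.
- by move: eta0 => h; apply/andP; split; lra.
- move=> S; pose S' := [set i | Some i \in S]%SET.
  have mC : measurable (~` \bigcup_i U i).
    by apply: measurableC; apply: fin_bigcup_measurable => [|i _];
      [exact: finite_finset|exact: mU].
  have mkS : measurable ([set z | cell U z \in S] `&` \bigcup_i U i : set (borel X)).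
    apply: measurableI; first exact: (measurable_fiber mk).
    by rewrite -[X in measurable X]setCK; exact: measurableC.
  have mlS : measurable [set z | cell V z \in neighbours E S].
    exact: (measurable_fiber ml).
  apply: (@le_trans _ _ (mu (([set z | cell U z \in S] `&` \bigcup_i U i) `|`
                             ~` \bigcup_i U i))).
    apply: le_measure; rewrite ?inE; [exact: (measurable_fiber mk)|exact: measurableU|].
    by move=> z zS; have [|] := pselect ((\bigcup_i U i) z); [left|right].
  apply: (le_trans (measureU2 _ mkS mC)).
  apply: (@le_trans _ _ ((soft_mass x S')%:E + eta%:E)%E).
    apply: leeD => //; apply: soft_mass_ge => // z [/= + [i _ Uz]].
    case kz: (cell U z) => [j|]; last by have := cell_none kz Uz.
    by move=> jS; exists j; [rewrite inE|exact: (cell_some kz)].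
  apply: (@le_trans _ _ ((soft_mass y S' + eta)%:E + eta%:E)%E).
    by rewrite leeD2r// lee_fin.
  rewrite -EFinD -addrA [leLHS]EFinD (_ : eta + eta = 2 * eta); last by lra.
  rewrite leeD2r//; apply: soft_mass_le => // z i; rewrite inE => iS iz /=.
  case lz: (cell V z) => [j|]; last by have := cell_none lz (iz : V i z).
  rewrite inE; apply/existsP; exists (Some i); rewrite iS /E.
  have : mdist (y j) z < 2 * eta := cell_some lz.
  have := metric_triangle (y i) z (y j).
  rewrite [mdist z (y j)]metric_sym; lra.
(* Two radii eta in X, two radii 2 eta in Y, two distances 4 eta between
   related centres of Y and the error eta add up to 15 eta. *)
- move=> z z' w w'; rewrite /E.
  case kz: (cell U z) => [i|//]; case lw: (cell V w) => [j|//] ij.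
  case kz': (cell U z') => [i'|//]; case lw': (cell V w') => [j'|//] ij'.
  have := cell_some kz; have := cell_some kz'; have := cell_some lw.
  have := cell_some lw'; rewrite /U /V /=.
  have := xy i i'; rewrite !ler_norml => /andP[].
  have := metric_triangle z (x i) z'; have := metric_triangle (x i) (x i') z'.
  have := metric_triangle (x i) z (x i'); have := metric_triangle z z' (x i').
  have := metric_triangle w (y j) w'; have := metric_triangle (y j) (y j') w'.
  have := metric_triangle (y j) w (y j'); have := metric_triangle w w' (y j').
  have := metric_triangle (y i) (y j) (y i').
  have := metric_triangle (y j) (y j') (y i').
  have := metric_triangle (y j) (y i) (y j').
  have := metric_triangle (y i) (y i') (y j').
  rewrite [mdist z (x i)]metric_sym [mdist z' (x i')]metric_sym.
  rewrite [mdist w (y j)]metric_sym [mdist w' (y j')]metric_sym.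
  rewrite [mdist (y j) (y i)]metric_sym [mdist (y j') (y i')]metric_sym.
  by move: ij ij' => *; apply/andP; split; lra.
Qed.

End matching.

Section test_polynomial.
Context (R : realType) (eta : R).
Context (N : nat) (delta : 'I_N -> 'I_N -> R) (a : {set 'I_N} -> R).
Hypothesis a01 : forall S, 0 <= a S <= 1.
Implicit Types X Y : mmspace R.

(** The number of terms of the deviation, so that its inverse normalises it. *)
Definition weight : R := (N * N + 2 ^ N)%:R.

Lemma weight_gt0 : 0 < weight.
Proof. by rewrite ltr0n addn_gt0 expn_gt0 orbT. Qed.

Lemma sum_set_const (c : R) : \sum_(S : {set 'I_N}) c = (2 ^ N)%:R * c.
Proof.
rewrite sumr_const (_ : #|_| = 2 ^ N)%N ?mulr_natl//.
by rewrite -cardsT -finset.powersetT card_powerset cardsT card_ord.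
Qed.

Lemma sum_pair_const (c : R) : \sum_(i < N) \sum_(j < N) c = (N * N)%:R * c.
Proof. by rewrite !sumr_const !card_ord -mulrnA mulr_natl. Qed.

Definition distortion (D : nat -> nat -> R) : R :=
  \sum_(i < N) \sum_(j < N) Num.min 1 `|D i j - delta i j|.

(** How far a tuple c of points of Y is from having the distances delta and
    the soft masses a. *)
Definition deviation Y (c : nat -> Y) : R :=
  distortion (fun i j => mdist (c i) (c j)) +
  \sum_S (soft_mass eta (fun i : 'I_N => c i) S - a S) ^+ 2.

(** The expectation of the products over independent points with indices z and
    z' turns them into the squares in the deviation. *)
Definition test_factor (D : nat -> nat -> R) (z z' : nat) : R :=
  (1 - weight^-1 * distortion D) - weight^-1 * \sum_S
    (soft eta S (fun i => D i z) - a S) * (soft eta S (fun i => D i z') - a S).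

(** Indexing by natural numbers, with default value 0, spares the casts between
    the indices of the N centres and those of the other points. *)
Definition entry n (A : 'M[R]_n) (i j : nat) : R :=
  if insub i is Some i' then if insub j is Some j' then A i' j' else 0 else 0.

(** The first N points play the role of the centres, and each factor uses two
    fresh points. *)
Definition test_polynomial m (A : 'M[R]_(N + m.*2)) : R :=
  \prod_(k < m) test_factor (entry A) (N + k.*2) (N + k.*2.+1).

Lemma continuous_entry n i j : continuous (fun A : 'M[R]_n => entry A i j).
Proof.
rewrite /entry; case: insub => [i'|]; last exact: continuous_const.
case: insub => [j'|]; last exact: continuous_const.
exact: coord_continuous.
Qed.

Lemma continuous_test_polynomial m : continuous (@test_polynomial m).
Proof.
apply: continuous_bigop => [|k _]; first exact: continuous_mul.
have cS S z : continuous (fun A : 'M[R]_(N + m.*2) =>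
    soft eta S (fun i => entry A i z) - a S).
  apply: continuous_sub; last exact: continuous_const.
  by apply: continuous_soft => i; exact: continuous_entry.
have cadd := @continuous_add R 'M[R]_(N + m.*2).
apply: continuous_sub.
  apply: continuous_sub; first exact: continuous_const.
  apply: continuous_mul; first exact: continuous_const.
  apply: continuous_bigop => // i _; apply: continuous_bigop => // j _.
  apply: continuous_minr; first exact: continuous_const.
  apply: continuous_normr; apply: continuous_sub; last exact: continuous_const.
  exact: continuous_entry.
apply: continuous_mul; first exact: continuous_const.
by apply: continuous_bigop => // S _; apply: continuous_mul.
Qed.

Lemma distortion_bound D : 0 <= distortion D <= (N * N)%:R.
Proof.
apply/andP; split.
  by apply: sumr_ge0 => i _; apply: sumr_ge0 => j _; rewrite le_min ler01/=.
rewrite -[leRHS]mulr1 -sum_pair_const; apply: ler_sum => i _; apply: ler_sum => j _.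
by rewrite ge_min lexx.
Qed.

Lemma norm_soft_sub S (t : 'I_N -> R) : `|soft eta S t - a S| <= 1.
Proof.
have := a01 S; have := soft_ge0 eta S t; have := soft_le1 eta S t.
by rewrite ler_norml => ? ? /andP[? ?]; apply/andP; split; lra.
Qed.

Lemma test_factor_bound D z z' : 0 <= test_factor D z z' <= 2.
Proof.
have W0 := weight_gt0; have /andP[d0 d1] := distortion_bound D.
rewrite /test_factor -addrA -opprD -mulrDr; set s := \sum_S _.
have : `|s| <= (2 ^ N)%:R.
  apply: (le_trans (ler_norm_sum _ _ _)).
  rewrite -[leRHS]mulr1 -sum_set_const; apply: ler_sum => S _.
  by rewrite normrM mulr_ile1// norm_soft_sub.
rewrite ler_norml => /andP[s0 s1].
have WE : weight = (N * N)%:R + (2 ^ N)%:R by rewrite /weight natrD.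
have h1 : weight^-1 * (distortion D + s) <= 1.
  by rewrite mulrC ler_pdivrMr// mul1r WE lerD.
have h2 : -1 <= weight^-1 * (distortion D + s).
  by rewrite mulrC ler_pdivlMr// mulN1r WE; move: ((N * N)%:R) d0 d1 => w *; lra.
by apply/andP; split; lra.
Qed.

Lemma test_polynomial_bound m (A : 'M[R]_(N + m.*2)) : `|test_polynomial A| <= 2 ^+ m.
Proof.
have ge0 k := test_factor_bound (entry A) (N + k.*2) (N + k.*2.+1).
rewrite ger0_norm; last by apply: prodr_ge0 => k _; case/andP: (ge0 k).
rewrite -[leRHS]mulr1 -[m in leRHS](card_ord m) -prodr_const.
by rewrite mulr1; apply: ler_prod => k _; exact: test_factor_bound.
Qed.

Lemma entry_dist_matrix Y n (x : n.-tuple Y) i j : (i < n)%N -> (j < n)%N ->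
  entry (dist_matrix (fun x y : Y => mdist x y) x) i j =
  mdist (nth point x i) (nth point x j).
Proof.
by move=> ni nj; rewrite /entry !insubT mxE !(tnth_nth point).
Qed.

(** For fixed centres the factors are independent, with expectation
    1 - deviation / weight. *)
Lemma test_polynomial_value Y m :
  (\int[product_measure_power (mm_measure Y) (N + m.*2)]_x
     (test_polynomial (dist_matrix (fun x y : Y => mdist x y) x))%:E =
   iter_int (mm_measure Y) N
     (fun s => ((1 - weight^-1 * deviation (nth (point : Y) s)) ^+ m)%:E))%E.
Proof.
pose dist (s : seq (borel Y)) i j := mdist (nth (point : Y) s i) (nth (point : Y) s j).
pose K s : R := \prod_(k < m) test_factor (dist s) (N + k.*2) (N + k.*2.+1).
have KE (x : (N + m.*2).-tuple (borel Y)) :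
    test_polynomial (dist_matrix (fun x y : Y => mdist x y) x) = K x.
  have lt2 (k : 'I_m) : (k.*2.+1 < m.*2)%N by rewrite -doubleS leq_double.
  apply: eq_bigr => k _; rewrite /test_factor.
  have iN (i : 'I_N) : (i < N + m.*2)%N by rewrite ltn_addr.
  have kz : (N + k.*2 < N + m.*2)%N by rewrite ltn_add2l ltnW.
  have kz' : (N + k.*2.+1 < N + m.*2)%N by rewrite ltn_add2l.
  congr (_ - _ * _ - _ * _).
    by apply: eq_bigr => i _; apply: eq_bigr => j _; rewrite entry_dist_matrix.
  apply: eq_bigr => S _; congr ((_ - _) * (_ - _)); congr soft; apply/funext => i;
    by rewrite entry_dist_matrix.
transitivity (\int[product_measure_power (mm_measure Y) (N + m.*2)]_x (K x)%:E)%E.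
  by apply: eq_integral => x _; rewrite KE.
rewrite product_measure_power_int; last 2 first.
- move=> s; apply: prodr_ge0 => k _.
  by case/andP: (test_factor_bound (dist s) (N + k.*2) (N + k.*2.+1)).
- apply: (@eq_measurable_fun _ _ _ _ _ (@test_polynomial m \o
      (fun x : (N + m.*2).-tuple (borel Y) => dist_matrix (fun x y : Y => mdist x y) x))).
    by move=> x _; exact: KE.
  apply: measurable_continuous_matrix; first exact: continuous_test_polynomial.
  by move=> i j; exact: measurable_dist_matrix_id.
rewrite iter_intD; apply: eq_iter_int => s sN.
pose f S (z : borel Y) : R := soft eta S (fun i : 'I_N => mdist (nth (point : Y) s i) z) - a S.
have f1 S z : `|f S z| <= 1 by exact: norm_soft_sub.
have mf S : measurable_fun setT (f S).
  by apply: measurable_funB => //; exact: measurable_soft_mdist.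
have fE S : \int[mm_measure Y]_z f S z =
    soft_mass eta (fun i : 'I_N => nth (point : Y) s i) S - a S.
  rewrite /f RintegralB//; last 2 first.
  - exact: integrable_soft_mdist.
  - by apply: (@integrable_bounded _ _ _ _ _ `|a S|).
  by rewrite Rintegral_cst// (congr1 fine (probability_setT (mm_measure Y))) mulr1.
have := iter_int_moments (mm_measure Y) mf f1 point m 1
  (1 - weight^-1 * distortion (dist s)) weight^-1.
rewrite mul1r /deviation mulrDr opprD addrA.
under eq_bigr do rewrite fE.
move=> <-; apply: eq_iter_int => s' s'm; rewrite mul1r /= /K; congr (_%:E).
apply: eq_bigr => k _; rewrite /test_factor.
have nthN i : (i < N)%N -> nth (point : Y) (s ++ s') i = nth point s i.
  by rewrite nth_cat sN => ->.
have nthD i : nth (point : Y) (s ++ s') (N + i) = nth point s' i.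
  by rewrite nth_cat sN ltnNge leq_addr/= addKn.
congr (_ - _ * _ - _ * _).
  by apply: eq_bigr => i _; apply: eq_bigr => j _; rewrite /dist !nthN.
apply: eq_bigr => S _; congr ((_ - _) * (_ - _)); congr soft; apply/funext => i;
  by rewrite /dist nthN// nthD.
Qed.

End test_polynomial.

Section separation.
Context (R : realType).
Implicit Types X Y : mmspace R.

Lemma soft_mass_bound (eta : R) : 0 < eta -> forall X N (c : 'I_N -> X) S,
  0 <= soft_mass eta c S <= 1.
Proof.
move=> eta0 X N c S; apply/andP; split; rewrite -lee_fin.
  apply: (@le_trans _ _ (mm_measure X set0)); first by rewrite measure0.
  exact: soft_mass_ge.
apply: (@le_trans _ _ (mm_measure X setT)); first exact: soft_mass_le.
by rewrite probability_setT.
Qed.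

(** Centres in the support have balls of positive measure around them. *)
Lemma supp_centres X (eta : R) : 0 < eta -> exists x : nat -> X,
  (forall n, supp (mm_measure X) (x n)) /\
  mm_measure X (\bigcup_n [set w | (mdist (x n) w < eta)%R]) = 1%E.
Proof.
move=> eta0; have [z dz] := dense_seq (mm_separable X).
have [p0 sp0] : exists p, supp (mm_measure X) p.
  apply: contrapT => /forallNP h; have := @measure_suppC R X.
  rewrite (_ : ~` _ = setT); last by rewrite -subTset => p _; exact: h.
  by rewrite probability_setT => /eqP; rewrite onee_eq0.
have /choice[x hx] : forall n, exists p, supp (mm_measure X) p /\
    forall w, supp (mm_measure X) w -> mdist (z n) w < eta / 2 -> mdist p w < eta.
  move=> n; have [[p [sp pn]]|h] := pselect (exists p,
    supp (mm_measure X) p /\ mdist (z n) p < eta / 2); last first.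
    by exists p0; split => // w sw wn; exfalso; apply: h; exists w.
  exists p; split => // w sw wn; have := metric_triangle p (z n) w.
  by rewrite [mdist p (z n)]metric_sym; lra.
exists x; split => [n|]; first by case: (hx n).
set B := \bigcup_n _.
have mB : measurable (B : set (borel X)) by apply: bigcupT_measurable => n; exact: borel_ball.
have := probability_setC (mm_measure X) mB.
rewrite (_ : mm_measure X (~` B) = 0%E); last first.
  apply: (@subset_measure0 _ _ _ (mm_measure X) _ (~` supp (mm_measure X))).
  - exact: measurableC.
  - by apply: measurableC; exact: measurable_supp.
  - apply: subsetC => w sw; have eta20 : 0 < eta / 2 by rewrite divr_gt0.
    by have [n nw] := dz w _ eta20; exists n => //; case: (hx n) => _; apply.
  - exact: measure_suppC.
rewrite -(fineK (fin_num_measure (mm_measure X) _ mB)) -EFinB => -[] ?; congr (_%:E); lra.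
Qed.

Lemma exists_pow_lt (s t p : R) : 0 <= s < t -> 0 < p -> exists m, s ^+ m < t ^+ m * p.
Proof.
move=> /andP[s0 st] p0; have t0 : 0 < t by exact: le_lt_trans st.
have : `|s / t| < 1.
  by rewrite ger0_norm ?divr_ge0// ?(ltW t0)// ltr_pdivrMr// mul1r.
move=> /cvg_expr/cvgrPdist_lt/(_ _ p0)[m _ /(_ m (leqnn m))].
rewrite /= sub0r normrN ger0_norm; last by rewrite exprn_ge0// divr_ge0// ltW.
rewrite expr_div_n ltr_pdivrMr ?exprn_gt0// => h; exists m; by rewrite mulrC.
Qed.

End separation.

Section test_value.
Context (R : realType) (eta : R) (eta0 : 0 < eta) (N : nat).
Context (delta : 'I_N -> 'I_N -> R) (a : {set 'I_N} -> R).
Hypothesis a01 : forall S, 0 <= a S <= 1.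
Implicit Types X Y : mmspace R.

Lemma deviation_bound Y (c : nat -> Y) :
  0 <= deviation eta delta a c <= weight R N.
Proof.
have := distortion_bound delta (fun i j => mdist (c i) (c j)) => /andP[d0 d1].
apply/andP; split; first by rewrite addr_ge0// sumr_ge0// => S _; exact: sqr_ge0.
rewrite /weight natrD lerD//.
rewrite -[leRHS]mulr1 -sum_set_const; apply: ler_sum => S _.
have := soft_mass_bound eta0 (fun i : 'I_N => c i) S; have := a01 S.
move=> /andP[? ?] /andP[? ?]; rewrite -real_normK ?num_real// exprn_ile1// ler_norml.
by apply/andP; split; lra.
Qed.

Lemma test_value_E Y m :
  ((polynomial_value (@test_polynomial R eta N delta a m) Y)%:E =
   iter_int (mm_measure Y) N (fun s => ((1 - (weight R N)^-1 *
     deviation eta delta a (nth (point : Y) s)) ^+ m)%:E))%E.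
Proof.
rewrite -test_polynomial_value// /polynomial_value /Rintegral fineK//.
apply: (integrable_fin_num measurableT).
apply: (@integrable_bounded _ _ _ _ _ (2 ^+ m)).
  apply: measurable_continuous_matrix; first exact: continuous_test_polynomial.
  by move=> i j; exact: measurable_dist_matrix_id.
by move=> x; exact: test_polynomial_bound.
Qed.

Lemma deviation_factor_ge0 Y (c : nat -> Y) :
  0 <= 1 - (weight R N)^-1 * deviation eta delta a c.
Proof.
have /andP[_ h] := deviation_bound c.
by rewrite subr_ge0 mulrC ler_pdivrMr ?weight_gt0// mul1r.
Qed.

(** If every tuple of points of Y deviated by kappa, then so small a value
    would result. *)
Lemma test_value_gt Y m kappa : 0 <= kappa <= weight R N ->
  (1 - (weight R N)^-1 * kappa) ^+ m <
    polynomial_value (@test_polynomial R eta N delta a m) Y ->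
  exists y : nat -> Y, deviation eta delta a y < kappa.
Proof.
move=> /andP[k0 kW] hY; apply: contrapT => /forallNP h.
move: hY; apply/negP; rewrite -leNgt -lee_fin test_value_E.
have W0 := weight_gt0 R N.
apply: iter_int_le.
- by move=> s; rewrite lee_fin exprn_ge0// deviation_factor_ge0.
- by rewrite exprn_ge0// subr_ge0 mulrC ler_pdivrMr// mul1r.
- move=> s _; rewrite lee_fin lerXn2r ?nnegrE ?deviation_factor_ge0//.
    by rewrite subr_ge0 mulrC ler_pdivrMr// mul1r.
  rewrite lerD2l lerN2 ler_pM2l ?invr_gt0// leNgt; apply/negP; exact: h.
Qed.

End test_value.

Section separating_polynomial.
Context (R : realType).
Implicit Types X Y : mmspace R.

(** Points in the balls of radius rho around the centres deviate by at most
    kappa / 2, so the test polynomial is at least p (1 - kappa / (2 W)) ^ m at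
    X, where p is the measure of the product of these balls; for large m
    this exceeds (1 - kappa / W) ^ m.  If the value at Y exceeds it too, then
    Y has points with deviation less than kappa. *)
Lemma separating_polynomial X (e : R) : 0 < e ->
  exists n (phi : 'M[R]_n -> R) (c : R),
  [/\ continuous phi, exists M, forall D, `|phi D| <= M,
      c < polynomial_value phi X &
      forall Y, c < polynomial_value phi Y -> gromov_box 1 X Y < e].
Proof.
move=> e0; pose eta := Num.min 1 (e / 16).
have eta0 : 0 < eta by rewrite lt_min ltr01 divr_gt0.
have eta1 : eta <= 1 by rewrite ge_min lexx.
have etae : 15 * eta < e.
  have : eta <= e / 16 by rewrite ge_min lexx orbT.
  by lra.
have [x [sx x1]] := supp_centres X eta0; set mu := mm_measure X in sx x1.
have [N hN] : exists N, (mu (~` \bigcup_(n in `I_N) [set w | (mdist (x n) w < eta)%R])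
    <= eta%:E)%E.
  near \oo => N; exists N; near: N; apply: finite_cover => // n; exact: borel_ball.
pose delta (i j : 'I_N) := mdist (x i) (x j).
pose a S := soft_mass eta (fun i : 'I_N => x i) S.
have a01 S : 0 <= a S <= 1 by exact: soft_mass_bound.
pose W := weight R N; have W0 : 0 < W by exact: weight_gt0.
have W1 : 1 <= W by rewrite ler1n addn_gt0 expn_gt0 orbT.
(* Differences of soft masses enter the deviation squared. *)
pose kappa := eta ^+ 2.
have k0 : 0 < kappa by rewrite exprn_gt0.
have keta : kappa <= eta by rewrite /kappa expr2 ler_piMl// ltW.
have k1 : kappa <= 1 by exact: le_trans eta1.
(* With this choice all W terms of the deviation are at most 2 r. *)
pose r := kappa / (4 * W); have r0 : 0 < r by rewrite divr_gt0// mulr_gt0.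
have rW : W * (2 * r) = kappa / 2.
  rewrite /r mulrCA [W * _]mulrC -mulrA invfM -[4^-1 * _ * _]mulrA.
  by rewrite mulVf ?gt_eqF// mulr1; lra.
have r1 : r <= 1.
  by have : 1 * (2 * r) <= W * (2 * r); [rewrite ler_wpM2r// mulr_ge0// ltW|lra].
pose rho := r * eta; have rho0 : 0 < rho by exact: mulr_gt0.
pose B i : set (borel X) := [set w | mdist (x i) w < rho].
have mB i : measurable (B i) by exact: borel_ball.
pose p := \prod_(i < N) fine (mu (B i)).
have p0 : 0 < p.
  apply: prodr_gt0 => i _; rewrite -lte_fin fineK ?fin_num_measure//.
  apply: (sx i); last by rewrite /B /= mdistxx.
  exact: open_mdist.
have [m hm] : exists m, (1 - W^-1 * kappa) ^+ m < (1 - W^-1 * (kappa / 2)) ^+ m * p.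
  apply: exists_pow_lt p0; rewrite subr_ge0 mulrC ler_pdivrMr// mul1r (le_trans k1)//=.
  by rewrite ltrD2l ltrN2 [kappa / W]mulrC ltr_pM2l ?invr_gt0//; lra.
exists (N + m.*2)%N, (@test_polynomial R eta N delta a m), ((1 - W^-1 * kappa) ^+ m).
split.
- exact: continuous_test_polynomial.
- by exists (2 ^+ m) => D; exact: test_polynomial_bound.
- apply: lt_le_trans hm _; rewrite -lee_fin test_value_E//.
  apply: iter_int_ge => //.
  + by move=> s; rewrite lee_fin exprn_ge0// deviation_factor_ge0.
  + rewrite exprn_ge0// subr_ge0 mulrC ler_pdivrMr// mul1r (le_trans _ W1)//; lra.
  move=> t0 s sN hs; rewrite lee_fin.
  have {}hs (i : 'I_N) : mdist (x i) (nth (point : X) s i) < rho.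
    by have := hs i (ltn_ord i); rewrite (set_nth_default (point : X)) ?sN.
  apply: lerXn2r; rewrite ?nnegrE ?deviation_factor_ge0//.
    by rewrite subr_ge0 mulrC ler_pdivrMr// mul1r (le_trans _ W1)//; lra.
  rewrite lerD2l lerN2 ler_pM2l ?invr_gt0// -rW /W /weight natrD mulrDl.
  apply: lerD.
    rewrite -sum_pair_const; apply: ler_sum => i _; apply: ler_sum => j _.
    rewrite ge_min; apply/orP; right.
    have : rho <= r by rewrite ler_piMr// ltW.
    have := metric_triangle (x i) (nth (point : X) s i) (x j).
    have := metric_triangle (nth (point : X) s i) (nth (point : X) s j) (x j).
    have := metric_triangle (nth (point : X) s i) (x i) (nth (point : X) s j).
    have := metric_triangle (x i) (x j) (nth (point : X) s j).
    have := hs i; have := hs j.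
    rewrite [mdist (nth _ s j) (x j)]metric_sym [mdist (nth _ s i) (x i)]metric_sym.
    rewrite /delta ler_norml.
    by move=> *; apply/andP; split; lra.
  rewrite -sum_set_const; apply: ler_sum => S _.
  have : `|soft_mass eta (fun i : 'I_N => nth (point : X) s i) S - a S| <= r.
    rewrite -[leRHS](@mulfK _ eta) ?gt_eqF//; apply: soft_mass_lipschitz => //.
      exact: ltW.
    by move=> i; rewrite metric_sym ltW// hs.
  move=> h; rewrite -real_normK ?num_real// expr2.
  apply: (@le_trans _ _ (r * 1)); last by lra.
  by apply: ler_pM => //; exact: le_trans r1.
- move=> Y /test_value_gt[]//; first by rewrite ltW//= (le_trans k1).
  move=> y; rewrite /deviation; set D := distortion _ _ => hy.
  have D0 : 0 <= D by case/andP: (distortion_bound delta (fun i j => mdist (y i) (y j))).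
  have Q0 S : 0 <= (soft_mass eta (fun i : 'I_N => y i) S - a S) ^+ 2 by exact: sqr_ge0.
  have sumQ0 : 0 <= \sum_S (soft_mass eta (fun i : 'I_N => y i) S - a S) ^+ 2.
    exact: sumr_ge0.
  apply: le_lt_trans etae.
  apply: (@gromov_box_le_matching _ _ eta0 X Y N (fun i => x i) (fun i => y i)).
  + apply: le_trans hN; rewrite le_eqVlt; apply/orP; left; apply/eqP; congr (mu (~` _)).
    apply/seteqP; split => w [i]; first by exists i; [exact: ltn_ord|].
    by move=> /= iN ?; exists (Ordinal iN).
  + move=> i j.
    have : Num.min 1 `|mdist (y i) (y j) - delta i j| < kappa.
      apply: le_lt_trans (hy); apply: (@le_trans _ _ D); last by rewrite lerDl.
      rewrite /D /distortion (bigD1 i)//= (bigD1 j)//= -addrA lerDl addr_ge0//.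
        by apply: sumr_ge0 => k _; rewrite le_min ler01/=.
      by apply: sumr_ge0 => k _; apply: sumr_ge0 => l _; rewrite le_min ler01/=.
    by rewrite gt_min ltNge k1/= => /ltW h; exact: le_trans h _.
  + move=> S.
    have : (soft_mass eta (fun i : 'I_N => y i) S - a S) ^+ 2 < kappa.
      apply: le_lt_trans hy; rewrite (bigD1 S)//= addrCA lerDl addr_ge0//.
      by apply: sumr_ge0.
    rewrite /kappa -real_normK ?num_real// ltr_pXn2r ?nnegrE ?(ltW eta0)//=.
    by rewrite ltr_norml => /andP[+ _]; rewrite /a; lra.
Unshelve. all: by end_near. Qed.

End separating_polynomial.

(** * The topology on isomorphism classes *)

Section gromov_weak_topology.
Context (R : realType).
Implicit Types (X Y : mmspace R) (C : mmclass R).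

(** The neighbourhoods in an initial topology are generated by the preimages of
    open sets under single polynomials. *)
Lemma gromov_weak_cvg (F : set_system (mmclass R)) C : Filter F ->
  F --> (C : gromov_weak R) <->
  forall Phi, mm_polynomial Phi -> forall O : set R, open O -> O (Phi C) ->
    F (Phi @^-1` O).
Proof.
move=> FF; split=> [/cvg_sup h Phi pPhi O oO OC|h].
  apply: (h (exist _ Phi pPhi)); have /= -> := @nbhsE (initial_topology Phi) C.
  by exists (Phi @^-1` O) => //; split => //; exists O.
apply/cvg_sup => -[Phi pPhi] A.
have /= -> := @nbhsE (initial_topology Phi) C.
by move=> [_ [[V oV <-] VC]] /filterS; apply; exact: h.
Qed.

Definition representative C : mmspace R := sval (cid (mm_class_surj C)).

Lemma representativeK C : mm_class (representative C) = C.
Proof. by rewrite /representative; case: cid. Qed.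

Definition class_box C C' : R := gromov_box 1 (representative C) (representative C').

Lemma class_boxE X Y : class_box (mm_class X) (mm_class Y) = gromov_box 1 X Y.
Proof. by apply: gromov_box_class; rewrite ?ltr01// representativeK. Qed.

Lemma polynomial_value_class n (phi : 'M[R]_n -> R) (M : R) X Y : continuous phi ->
  (forall D, `|phi D| <= M) -> mm_class X = mm_class Y ->
  polynomial_value phi X = polynomial_value phi Y.
Proof.
move=> cphi phiM XY; apply/eqP; rewrite -subr_eq0 -normr_le0; apply/ler_addgt0Pr => eps eps0.
rewrite add0r; have [e e0] := polynomial_value_continuous X cphi phiM eps0; apply.
have [h _] := mm_class_iso XY.
exact: (le_lt_trans (gromov_box_iso0 ltr01 h)).
Qed.

Lemma mm_polynomial_value n (phi : 'M[R]_n -> R) (M : R) : continuous phi ->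
  (forall D, `|phi D| <= M) ->
  mm_polynomial (fun C => polynomial_value phi (representative C)).
Proof.
move=> cphi phiM; exists n, phi; split => //; first by exists M.
by move=> X; apply: (polynomial_value_class cphi phiM); rewrite representativeK.
Qed.

(** Polynomials are continuous for Gromov's metric, so open sets contain balls;
    a set containing a ball around each of its points contains the set where
    the separating polynomial of that ball is large. *)
Lemma class_box_induces : @induces_topology R (gromov_weak R) class_box.
Proof.
move=> U; split=> [oU C UC|hU].
  pose F : set_system (mmclass R) :=
    filter_from [set e : R | 0 < e] (fun e => [set C' | class_box C C' < e]).
  have FF : Filter F.
    apply: filter_from_filter; first by exists 1; rewrite /= ltr01.
    move=> r s r0 s0; exists (Num.min r s); first by rewrite /= lt_min r0.
    by move=> C' /=; rewrite lt_min => /andP.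
  have : F --> (C : gromov_weak R).
    apply/gromov_weak_cvg => Phi [n [phi [cphi [M phiM] PhiE]]] O oO OC.
    have /nbhs_ballP[r /= r0 rO] : nbhs (Phi C) O by apply: open_nbhs_nbhs.
    have r20 : 0 < r / 2 by rewrite divr_gt0.
    have [e e0 he] := polynomial_value_continuous (representative C) cphi phiM r20.
    exists e => // C' /he h; apply: rO; apply: (@le_lt_trans _ _ (r / 2)); last by lra.
    by rewrite -(representativeK C) -(representativeK C') !PhiE.
  by apply; apply: open_nbhs_nbhs.
rewrite openE => C UC; have [e e0 eU] := hU C UC.
have [n [phi [c [cphi [M phiM] cC hc]]]] := separating_polynomial (representative C) e0.
apply: (@filterS _ _ _ ((fun C => polynomial_value phi (representative C)) @^-1`
    [set t | c < t])).
  by move=> C' /= /hc; exact: eU.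
have /gromov_weak_cvg h : nbhs (C : gromov_weak R) --> (C : gromov_weak R) by [].
by apply: (h _ (mm_polynomial_value cphi phiM)) => //; exact: open_gt.
Qed.

End gromov_weak_topology.

Theorem corollary3p2 (R : realType) :
  (forall (lambda : R) (X1 X2 : mmspace R), 0 < lambda ->
     Num.min 2 lambda^-1 * gromov_prohorov X1 X2 <= gromov_box lambda X1 X2 /\
     gromov_box lambda X1 X2 <= Num.max 2 lambda^-1 * gromov_prohorov X1 X2) /\
  (exists delta : gromov_weak R -> gromov_weak R -> R,
     (forall X1 X2 : mmspace R,
        delta (mm_class X1) (mm_class X2) = gromov_box 1 X1 X2) /\
     induces_topology delta).
Proof.
split=> [lambda X1 X2 lambda0|].
  by split; [exact: gromov_box_lower_bound|exact: gromov_box_upper_bound].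
exists (@class_box R); split; [exact: class_boxE|exact: class_box_induces].
Qed.
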